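(* For any rooted binary tree $T$ with $n$ leaves, the modified centroid decomposition $\mathit{MCD}(T)$ can be built in $\mathrm{O}(n\log n)$ time in the RAM model.
   Context: A rooted binary tree is one in which every internal node has exactly two children, a left and a right child. A component of $T$ is a connected set of nodes of $T$, and $|C|$ denotes the number of nodes of a component $C$. An edge of $T$ crosses the boundary of $C$ if exactly one of its endpoints lies in $C$. It is an edge from below if its endpoint in $C$ is the parent endpoint. A centroid of a component $C$ is a node $u\in C$ such that every connected component of $C\setminus\{u\}$ has at most $|C|/2$ nodes. Removing a node $s$ from $C$ leaves at most three connected components: $C_l$ containing the left child of $s$, $C_r$ containing the right child of $s$, and $C_p$ containing the parent of $s$, each intersected with $C$ and possibly empty. The modified centroid decomposition $\mathit{MCD}(T)$ is a ternary tree built recursively, starting from the component $C=T$. For the current component $C$ a splitting node $s$ is chosen. If $C$ has no edge from below, $s$ is a centroid $c$ of $C$. Otherwise $C$ has exactly one edge $(x,y)$ from below with $x\in C$; let $c$ be a centroid of $C$, and let $s$ be the lowest common ancestor of $x$ and $c$. The node of $\mathit{MCD}(T)$ for $C$ stores $s$. Its children are the nodes of $\mathit{MCD}(T)$ for the nonempty components among $C_l,C_r,C_p$ obtained by removing $s$ from $C$. *)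

(* Defs.v *)
From mathcomp Require Import all_boot.
Set Implicit Arguments. Unset Strict Implicit. Unset Printing Implicit Defensive.

Inductive btree := BLeaf | BNode of btree & btree.

Fixpoint nleaves (t : btree) : nat :=
  match t with BLeaf => 1 | BNode l r => nleaves l + nleaves r end.

Fixpoint bsize (t : btree) : nat :=
  match t with BLeaf => 1 | BNode l r => (bsize l + bsize r).+1 end.

(* Node addresses (false = left, true = right), listed in preorder.
   Node number i of T is the node with address nth [::] (paths T) i. *)
Fixpoint paths (t : btree) : seq (seq bool) :=
  match t with
  | BLeaf => [:: [::]]
  | BNode l r => [::] :: map (cons false) (paths l) ++ map (cons true) (paths r)
  end.

(* longest common prefix of two addresses (address of the LCA) *)
Fixpoint lcp (p q : seq bool) : seq bool :=
  match p, q with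
  | a :: p', b :: q' => if a == b then a :: lcp p' q' else [::]
  | _, _ => [::]
  end.

Section MCD.
Variable T : btree.
Local Notation node := 'I_(bsize T).

Definition addr (x : node) : seq bool := nth [::] (paths T) x.

Definition parentOf (x y : node) : bool :=
  (size (addr y) == (size (addr x)).+1) && (addr x == take (size (addr x)) (addr y)).

Definition adj (x y : node) : bool := parentOf x y || parentOf y x.

Definition restr (A : {set node}) : rel node :=
  [rel x y | [&& x \in A, y \in A & adj x y]].

Definition compo (A : {set node}) (x : node) : {set node} :=
  [set y | (x \in A) && connect (restr A) x y].

Definition connected_set (A : {set node}) : bool :=
  [forall x, forall y, (x \in A) && (y \in A) ==> connect (restr A) x y].

Definition centroid (C : {set node}) (u : node) : bool :=
  (u \in C) &&
  [forall y, (y \in C :\ u) ==> (2 * #|compo (C :\ u) y| <= #|C|)].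

Definition childOf (b : bool) (s : node) : option node :=
  [pick j | addr j == rcons (addr s) b].
Definition parentNode (s : node) : option node := [pick j | parentOf j s].

Definition piece (C : {set node}) (s : node) (o : option node) : {set node} :=
  if o is Some x then compo (C :\ s) x else set0.

Definition pieces (C : {set node}) (s : node) : seq {set node} :=
  [:: piece C s (childOf false s); piece C s (childOf true s);
      piece C s (parentNode s)].

Definition from_below (C : {set node}) (x y : node) : bool :=
  [&& x \in C, y \notin C & parentOf x y].

Definition split_ok (C : {set node}) (s : node) : Prop :=
  ((forall x y, ~~ from_below C x y) /\ centroid C s) \/
  (exists x y, from_below C x y /\
     (forall x' y', from_below C x' y' -> x' = x /\ y' = y) /\
     exists c, centroid C c /\ addr s = lcp (addr x) (addr c)).

(* Ternary trees storing node numbers; MEmpty marks an absent child. *)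
Inductive mtree := MEmpty | MNode of nat & mtree & mtree & mtree.

(* t is a (the, up to choices of centroids and order of children)
   modified centroid decomposition of the component C *)
Fixpoint is_mcd (C : {set node}) (t : mtree) : Prop :=
  match t with
  | MEmpty => C = set0
  | MNode s a b c =>
      exists s' : node, nat_of_ord s' = s /\ s' \in C /\ split_ok C s' /\
      exists D1 D2 D3, perm_eq [:: D1; D2; D3] (pieces C s') /\
        is_mcd D1 a /\ is_mcd D2 b /\ is_mcd D3 c
  end.

End MCD.


Inductive instr :=
| IConst of nat & nat
| IAdd of nat & nat & nat
| ISub of nat & nat & nat        (* m[a] := m[b] - m[c] (truncated) *)
| IMul of nat & nat & nat
| IDiv of nat & nat & nat        (* m[a] := m[b] / m[c] (0 if m[c] = 0) *)
| ILt of nat & nat & nat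
| ILoad of nat & nat
| IStore of nat & nat
| IJz of nat & nat
| IJmp of nat
| IHalt.

Definition memory := nat -> nat.
Definition state := (nat * memory)%type.

Definition rd (W : nat) (m : memory) (a : nat) : option nat :=
  if a < W then Some (m a) else None.

Definition wr (W : nat) (m : memory) (a v : nat) : option memory :=
  if (a < W) && (v < W) then Some (fun i => if i == a then v else m i) else None.

Definition is_halt (i : instr) : bool := if i is IHalt then true else false.

Definition binop (W : nat) (P : seq instr) (pc : nat) (m : memory)
  (f : nat -> nat -> nat) (a b c : nat) : option state :=
  match rd W m b, rd W m c with
  | Some x, Some y => omap (fun m' => (pc.+1, m')) (wr W m a (f x y))
  | _, _ => None
  end.

(* one step; None = fault (word overflow / address out of range) *)
Definition step (W : nat) (P : seq instr) (s : state) : option state :=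
  let: (pc, m) := s in
  match nth IHalt P pc with
  | IConst a k => omap (fun m' => (pc.+1, m')) (wr W m a k)
  | IAdd a b c => binop W P pc m addn a b c
  | ISub a b c => binop W P pc m subn a b c
  | IMul a b c => binop W P pc m muln a b c
  | IDiv a b c => binop W P pc m divn a b c
  | ILt a b c => binop W P pc m (fun x y => nat_of_bool (x < y)) a b c
  | ILoad a b =>
      match rd W m b with
      | Some p => match rd W m p with
                  | Some v => omap (fun m' => (pc.+1, m')) (wr W m a v)
                  | None => None end
      | None => None end
  | IStore a b =>
      match rd W m a, rd W m b with
      | Some p, Some v => omap (fun m' => (pc.+1, m')) (wr W m p v)
      | _, _ => None end
  | IJz a l => match rd W m a with
               | Some v => Some (if v == 0 then l else pc.+1, m)
               | None => None end
  | IJmp l => Some (l, m)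
  | IHalt => Some s
  end.

(* run P for at most [fuel] steps; Some final state iff it halts (reaches
   IHalt, or a pc outside the program) within [fuel] steps without fault *)
Fixpoint run (W : nat) (P : seq instr) (fuel : nat) (s : state) : option state :=
  if is_halt (nth IHalt P s.1) then Some s
  else match fuel with
       | 0 => None
       | f.+1 => obind (run W P f) (step W P s)
       end.

Definition child_code (T : btree) (p : seq bool) (b : bool) : nat :=
  if rcons p b \in paths T then (index (rcons p b) (paths T)).+1 else 0.

(* m[0] = number of nodes; for node i (preorder numbering, root = 0):
   m[1+2i] = code of left child, m[2+2i] = code of right child. *)
Definition input (T : btree) : memory :=
  fun a =>
    if a == 0 then bsize T
    else let i := (a.-1)./2 in
         if i < bsize T then child_code T (nth [::] (paths T) i) (odd a.-1)
         else 0.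

(* Output convention: on halting, m[0] = code of the root of the MCD
   (node index + 1), m[1] = base address B; for each MCD node storing
   tree node j, m[B+3j], m[B+3j+1], m[B+3j+2] are the codes of its
   (up to three) children (0 = no child). *)
Fixpoint decodes (m : memory) (B code : nat) (t : mtree) : Prop :=
  match t with
  | MEmpty => code = 0
  | MNode j a b c =>
      code = j.+1 /\ decodes m B (m (B + 3 * j)) a /\
      decodes m B (m (B + 3 * j).+1) b /\ decodes m B (m (B + 3 * j).+2) c
  end.

(* Main.v *)
Require Import Defs.
From mathcomp Require Import all_boot zify.
Set Implicit Arguments. Unset Strict Implicit. Unset Printing Implicit Defensive.

(* All components are split simultaneously, in rounds. With the nodes in preorder, one
   downward scan computes the size of the part of its component below every node and
   whether a removed node lies below it; one upward scan computes the top of every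
   component and marks the good nodes, those whose subtree contains more than half of the
   component and the node [x] of the edge from below, if there is one. The lowest good
   node of a component is its splitting node: the centroid, or the lowest common ancestor
   of [x] and the centroid. A last scan removes the splitting nodes and records them. Each
   round takes linear time and halves the square of the size of a component, counted twice
   if the component has an edge from below, so O(log n) rounds suffice. *)

(** * Machine executions and a while language *)

(** Working in rounds avoids a recursion stack and lists of components. The set of remaining nodes
    determines the components, and each is represented by its highest node. The only other datum
    kept for a component is the output cell that awaits its splitting node, so the decomposition is
    written top down while it is still incomplete. No logarithm is computed: a counter doubles
    whenever the potential halves, and the loop stops once the counter exceeds the square of the
    number of nodes, which leaves no room for a nonempty component. The machine faults on words and
    addresses beyond [W], so every value needs a bound. The program is therefore written in a small
    language whose compiler is verified once. Stored entries stay within a quadratic bound [K],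
    intermediate values within [K ^ 16]; this fixes the polynomial requirement on [W]. *)

Section Steps.
Variables (W : nat) (P : seq instr).

Fixpoint steps (n : nat) (s : state) : option state :=
  if n is n'.+1 then obind (steps n') (step W P s) else Some s.

Lemma steps_trans n1 n2 s s1 s2 :
  steps n1 s = Some s1 -> steps n2 s1 = Some s2 -> steps (n1 + n2) s = Some s2.
Proof.
elim: n1 s => [|n IH] s /=; first by case=> ->.
case: (step W P s) => //= s0; apply: IH.
Qed.

(** A halting state is a fixed point of [step], so if [run] stops before [n] steps, the remaining
    steps change nothing. *)
Lemma run_steps n fuel s s' :
  steps n s = Some s' -> is_halt (nth IHalt P s'.1) -> n <= fuel ->
  run W P fuel s = Some s'.
Proof.
elim: n fuel s => [|n IH] fuel s /=.
  by case=> <- hs _; case: fuel => [|fuel] /=; rewrite hs.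
case: fuel => [//|fuel]; rewrite ltnS /= => hs halt_s' le_n.
case: ifP => [halt_s|_].
  have fixed k : steps k s = Some s.
    elim: k => [//|k IHk] /=.
    by case: s halt_s IHk {hs} => pc m /=; case: (nth _ _ _).
  by move: (fixed n.+1); rewrite /= hs => -[->].
by case: (step W P s) hs => //= s1 hs; apply: IH.
Qed.

Definition code_at pc c := exists P1 P2, P = P1 ++ c ++ P2 /\ size P1 = pc.

Lemma code_at_cat pc c1 c2 :
  code_at pc (c1 ++ c2) -> code_at pc c1 /\ code_at (pc + size c1) c2.
Proof.
case=> P1 [P2 [eP <-]]; split; first by exists P1, (c2 ++ P2); rewrite eP -catA.
by exists (P1 ++ c1), P2; rewrite eP size_cat -!catA.
Qed.

Lemma code_at_cons pc i c :
  code_at pc (i :: c) -> nth IHalt P pc = i /\ code_at pc.+1 c.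
Proof.
case=> P1 [P2 [eP <-]]; split; first by rewrite eP nth_cat ltnn subnn.
by exists (rcons P1 i), P2; rewrite eP size_rcons cat_rcons.
Qed.

(* [None] also for the instructions that may jump or halt. *)
Definition istep (i : instr) (m : memory) : option memory :=
  match i with
  | IJz _ _ | IJmp _ | IHalt => None
  | _ => omap snd (step W [:: i] (0, m))
  end.

Lemma stepE pc i m m' : nth IHalt P pc = i -> istep i m = Some m' ->
  step W P (pc, m) = Some (pc.+1, m').
Proof.
move=> hi; rewrite [step W P _]/= hi; case: i {hi} => //= [a k|a b c|a b c|a b c|a b c|a b c|a b|a b];
  rewrite /istep /= /binop.
1: by case: wr => //= ? [->].
1-5: by case: (rd W m b) => //= x; case: (rd W m c) => //= y; case: wr => //= ? [->].
- by case: (rd W m b) => //= x; case: (rd W m x) => //= y; case: wr => //= ? [->].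
- by case: (rd W m a) => //= x; case: (rd W m b) => //= y; case: wr => //= ? [->].
Qed.

#[local] Arguments step : simpl never.
#[local] Arguments istep : simpl never.

Fixpoint isteps (c : seq instr) (m : memory) : option memory :=
  if c is i :: c' then obind (isteps c') (istep i m) else Some m.

Lemma isteps_cat c1 c2 m :
  isteps (c1 ++ c2) m = obind (isteps c2) (isteps c1 m).
Proof. by elim: c1 m => //= i c1 IH m; case: istep => //=. Qed.

Lemma isteps_catS c1 c2 m m1 :
  isteps c1 m = Some m1 -> isteps (c1 ++ c2) m = isteps c2 m1.
Proof. by rewrite isteps_cat => ->. Qed.

Lemma steps_isteps pc c m m' : code_at pc c -> isteps c m = Some m' ->
  steps (size c) (pc, m) = Some (pc + size c, m').
Proof.
elim: c pc m => [|i c IH] pc m /=; first by rewrite addn0 => _ [->].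
case/code_at_cons=> hi hc; case E: istep => [m1|] //= hm.
by rewrite (stepE hi E) /= (IH _ _ hc hm) addSnnS.
Qed.

End Steps.
#[local] Arguments step : simpl never.
#[local] Arguments istep : simpl never.

(** * A small imperative language and its compiler *)

Inductive aop := Add | Sub | Mul | Lt.

Definition aopE o : nat -> nat -> nat :=
  match o with
  | Add => addn | Sub => subn | Mul => muln | Lt => fun x y => x < y
  end.

(* [EI e] reads the even memory cell [2 * e]; [EA f e] is entry [e] of array [f]. *)
Inductive expr :=
| EC of nat
| ER of nat
| EA of nat & expr
| EI of expr
| EO of aop & expr & expr.

Inductive cmd :=
| CSet of nat & expr
| CSto of nat & expr & expr
| CSeq of cmd & cmd
| CWhen of expr & cmd
| CWhile of expr & cmd.

Record st := St { reg : nat -> nat; arr : nat -> nat -> nat }.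

Definition set_reg s r x := St (fun j => if j == r then x else reg s j) (arr s).
Definition set_arr s f v x :=
  St (reg s) (fun f' v' => if (f' == f) && (v' == v) then x else arr s f' v').

(* Number of registers, the first of which holds the array stride; register [i]
   is memory cell [2 * i + 1] and the cells of the registers [nreg], [nreg + 1], ...
   hold the intermediate values of expressions. *)
Definition nreg := 8.
Definition narr := 8.

Definition ra i := i.*2.+1.

Definition opI o := match o with
  | Add => IAdd | Sub => ISub | Mul => IMul | Lt => ILt end.

Definition cAddr f d t :=
  [:: IConst (ra t) f; IMul (ra t) (ra t) (ra 0); IAdd (ra d) (ra d) (ra t)].

#[local] Arguments cAddr : simpl never.

Fixpoint cE (e : expr) (d : nat) : seq instr :=
  match e with
  | EC k => [:: IConst (ra d) k]
  | ER r => [:: IConst (ra d) 0; IAdd (ra d) (ra d) (ra r)]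
  | EA f e => cE e d ++ cAddr f d d.+1 ++ [:: ILoad (ra d) (ra d)]
  | EI e => cE e d ++ [:: IAdd (ra d) (ra d) (ra d); ILoad (ra d) (ra d)]
  | EO o a b => cE a d ++ cE b d.+1 ++ [:: opI o (ra d) (ra d) (ra d.+1)]
  end.

(** Computed apart from [cC], because absolute jump targets involve the length of code that follows
    the jump. *)
Fixpoint csz (c : cmd) : nat :=
  match c with
  | CSet r e => size (cE e nreg) + 2
  | CSto f i e => size (cE i nreg) + size (cE e nreg.+1) + 4
  | CSeq c1 c2 => csz c1 + csz c2
  | CWhen e c => size (cE e nreg) + 1 + csz c
  | CWhile e c => size (cE e nreg) + 1 + csz c + 1
  end.

Fixpoint cC (c : cmd) (pc : nat) : seq instr :=
  match c with
  | CSet r e => cE e nreg ++ [:: IConst (ra nreg.+1) 0; IAdd (ra r) (ra nreg) (ra nreg.+1)]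
  | CSto f i e => cE i nreg ++ cE e nreg.+1 ++
      cAddr f nreg nreg.+2 ++ [:: IStore (ra nreg) (ra nreg.+1)]
  | CSeq c1 c2 => cC c1 pc ++ cC c2 (pc + csz c1)
  | CWhen e c => let n := size (cE e nreg) in
      cE e nreg ++ [:: IJz (ra nreg) (pc + (n + 1 + csz c))] ++ cC c (pc + n + 1)
  | CWhile e c => let n := size (cE e nreg) in
      cE e nreg ++ [:: IJz (ra nreg) (pc + (n + 1 + csz c + 1))] ++ cC c (pc + n + 1)
       ++ [:: IJmp pc]
  end.

Lemma size_cC c pc : size (cC c pc) = csz c.
Proof.
elim: c pc => [r e|f i e|c1 IH1 c2 IH2|e c IH|e c IH] pc /=;
  by rewrite !size_cat /= ?IH1 ?IH2 ?size_cat ?IH /=; lia.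
Qed.

(* Such expressions obey the bound on the entries of the state, so they may serve as indices. *)
Definition small (e : expr) := if e is EO _ _ _ then false else true.

(** Register 0 is excluded because it holds the stride, array 0 because its place in memory is taken
    by the input and the registers. *)
Fixpoint wfE (e : expr) : bool :=
  match e with
  | EC k => k <= 4
  | ER r => 0 < r < nreg
  | EA f e => [&& 0 < f, f < narr, small e & wfE e]
  | EI e => small e && wfE e
  | EO o a b => wfE a && wfE b
  end.

(** Serves as the exponent in the bound [K ^ esz e] on the value, and bounds the number of scratch
    registers used. *)
Fixpoint esz (e : expr) : nat :=
  match e with
  | EC _ | ER _ => 1
  | EA _ e | EI e => esz e
  | EO _ a b => esz a + esz b
  end.

Fixpoint wfC (c : cmd) : bool :=
  match c with
  | CSet r e => [&& 0 < r < nreg, wfE e & esz e <= 16]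
  | CSto f i e => [&& 0 < f < narr, small i, wfE i, esz i <= 16, wfE e & esz e <= 16]
  | CSeq c1 c2 => wfC c1 && wfC c2
  | CWhen e c | CWhile e c => [&& wfE e, esz e <= 16 & wfC c]
  end.

Lemma esz_gt0 e : 0 < esz e.
Proof. by elim: e => //= o a Ha b Hb; lia. Qed.

(** * Simulation of the language by the machine *)

Section Sim.
Variables (W M K : nat) (I : nat -> nat).

Fixpoint ev (e : expr) (s : st) : nat :=
  match e with
  | EC k => k
  | ER r => reg s r
  | EA f e => arr s f (ev e s)
  | EI e => I (ev e s)
  | EO o a b => aopE o (ev a s) (ev b s)
  end.

Definition bounded s := (forall r, reg s r <= K) /\ (forall f v, arr s f v <= K).

Hypotheses (K4 : 4 <= K) (IK : forall x, I x <= K).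
Hypotheses (KM : K.*2 < M) (M100 : 100 <= M) (MW : narr * M <= W) (KW : K ^ 16 < W).

Lemma ev_small e s : bounded s -> wfE e -> small e -> ev e s <= K.
Proof. by case=> bR bA; case: e => //= k hk _; apply: leq_trans hk _. Qed.

Lemma ev_bound e s : bounded s -> wfE e -> ev e s <= K ^ esz e.
Proof.
move=> bs; have sm e' : wfE e' -> small e' -> ev e' s <= K ^ esz e'.
  move=> w sme; apply: leq_trans (ev_small bs w sme) _.
  by rewrite -{1}(expn1 K) leq_pexp2l ?esz_gt0 //; lia.
elim: e => [k|r|f e IHe|e IHe|o a IHa b IHb] w; try exact: sm.
case/andP: w => wa wb /=; move: (IHa wa) (IHb wb) => {}IHa {}IHb.
have Ka : 1 < K ^ esz a by rewrite -(expn0 K) ltn_exp2l ?esz_gt0 //; lia.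
have Kb : 1 < K ^ esz b by rewrite -(expn0 K) ltn_exp2l ?esz_gt0 //; lia.
by rewrite expnD; case: o => /=; nia.
Qed.

Lemma ev_ltW e s : bounded s -> wfE e -> esz e <= 16 -> ev e s < W.
Proof.
move=> bs w le; apply: leq_ltn_trans (ev_bound bs w) _.
by apply: leq_ltn_trans KW; rewrite leq_pexp2l //; lia.
Qed.

Definition rep (m : memory) (s : st) :=
  [/\ m (ra 0) = M, forall r, 0 < r < nreg -> m (ra r) = reg s r,
      forall f v, 0 < f < narr -> v <= K -> m (f * M + v) = arr s f v
    & forall x, x <= K -> m x.*2 = I x].

(** Scratch cells from register [d] on. They avoid the represented input, which is even, and the
    arrays, which start at [M]. *)
Definition tmp d a := [&& odd a, ra d <= a & a < M].

Lemma arr_ntmp d f v : 0 < f < narr -> ~~ tmp d (f * M + v).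
Proof.
move=> /andP[f0 _]; have := leq_pmull M f0; rewrite /tmp => h.
by rewrite !negb_and -!leqNgt [_ <= f * M + v](leq_trans h) ?leq_addr ?orbT.
Qed.

Lemma rep_frame m m' s d : nreg <= d -> rep m s ->
  (forall a, ~~ tmp d a -> m' a = m a) -> rep m' s.
Proof.
move=> hd [h1 h2 h3 h4] fr; split.
- by rewrite fr //; move: hd; rewrite /nreg /tmp /ra; lia.
- by move=> r hr; rewrite fr ?h2 //; move: hd hr; rewrite /nreg /tmp /ra; lia.
- by move=> f v hf hv; rewrite fr ?h3 // arr_ntmp.
- by move=> x hx; rewrite fr ?h4 // /tmp odd_double.
Qed.

Definition upd (m : memory) a v : memory := fun i => if i == a then v else m i.

Lemma istep_const m a k : a < W -> k < W -> istep W (IConst a k) m = Some (upd m a k).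
Proof. by move=> ha hk; rewrite /istep /step /= /wr ha hk. Qed.

Lemma istep_op o m a b c : a < W -> b < W -> c < W -> aopE o (m b) (m c) < W ->
  istep W (opI o a b c) m = Some (upd m a (aopE o (m b) (m c))).
Proof.
by move=> ha hb hc; case: o => /= h; rewrite /istep /step /= /binop /rd /wr ha hb hc h.
Qed.

Lemma istep_load m a b : a < W -> b < W -> m b < W -> m (m b) < W ->
  istep W (ILoad a b) m = Some (upd m a (m (m b))).
Proof. by move=> ha hb h h'; rewrite /istep /step /= /rd /wr hb h ha h'. Qed.

Lemma istep_store m a b : a < W -> b < W -> m a < W -> m b < W ->
  istep W (IStore a b) m = Some (upd m (m a) (m b)).
Proof. by move=> ha hb h h'; rewrite /istep /step /= /rd /wr ha hb h h'. Qed.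

Lemma upd_eq m a v : upd m a v a = v. Proof. by rewrite /upd eqxx. Qed.

Lemma upd_neq m a v i : i != a -> upd m a v i = m i.
Proof. by rewrite /upd => /negbTE ->. Qed.

Lemma raW d : d < 40 -> ra d < W.
Proof. by move: MW; rewrite /narr /ra; lia. Qed.

Lemma frame_upd d d' m m1 v : d <= d' -> d' < 40 -> (forall a, ~~ tmp d a -> m1 a = m a) ->
  forall a, ~~ tmp d a -> upd m1 (ra d') v a = m a.
Proof.
move=> hd h40 fr a ha; rewrite upd_neq ?fr //.
by apply: contraNneq ha => ->; rewrite /tmp /ra; lia.
Qed.

Lemma upd_ra m i j v : i != j -> upd m (ra i) v (ra j) = m (ra j).
Proof using Type. by clear; move=> h; rewrite upd_neq // /ra; lia. Qed.

Lemma KltW : K < W.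
Proof. by apply: leq_ltn_trans KW; rewrite -{1}(expn1 K) leq_pexp2l //; lia. Qed.

Lemma MltW : M < W. Proof. by move: MW; rewrite /narr; lia. Qed.

Lemma cAddr_ok f d t m : f < narr -> m (ra 0) = M -> m (ra d) <= K ->
  0 < d < 40 -> 0 < t < 40 -> d != t ->
  exists m', [/\ isteps W (cAddr f d t) m = Some m', m' (ra d) = f * M + m (ra d)
                & forall a, a != ra d -> a != ra t -> m' a = m a].
Proof.
move=> fn m0 mK hd ht dt; have := KltW; have := MltW => hM hK.
have fM : f * M + M <= W by move: MW; nia.
have rd1 : ra d < W by apply: raW; lia.
have rt1 : ra t < W by apply: raW; lia.
have n0 : t != 0 by lia.
eexists; split.
- rewrite /= istep_const //=; last by move: fn MW; rewrite /narr; lia.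
  rewrite -/(opI Mul) istep_op //= ?upd_eq ?upd_ra ?m0 //; [|apply: raW; lia|lia].
  by rewrite -/(opI Add) istep_op //= !upd_eq upd_ra 1?eq_sym // upd_ra 1?eq_sym //; lia.
- by rewrite !upd_eq !upd_ra 1?eq_sym // addnC.
- by move=> a ha hta; rewrite !upd_neq.
Qed.

(** Only scratch cells from [d] on change, so a left operand in [d] survives the evaluation of the
    right one at [d.+1]. *)
Lemma cE_ok e d m s : wfE e -> esz e <= 16 -> nreg <= d -> d + esz e <= 36 ->
  bounded s -> rep m s ->
  exists m', [/\ isteps W (cE e d) m = Some m', m' (ra d) = ev e s
                & forall a, ~~ tmp d a -> m' a = m a].
Proof.
move=> w; have := KltW; have := MltW => hM hK.
elim: e d m w => [k|r|f e IH|e IH|o a IHa b IHb] d m w sz hd hD bs rp;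
  (have hd8 : 8 <= d by []);
  (have rd0 : ra d < W by apply: raW; lia); (have rd1 : ra d.+1 < W by apply: raW; lia).
- eexists; split; first by rewrite /= istep_const //; move: w => /=; lia.
    by rewrite upd_eq.
  by apply: (frame_upd _ (leqnn d)) => //; lia.
- have rr : ra r < W by apply: raW; move: w; rewrite /= /nreg; lia.
  have nr : r != d by move: w hd; rewrite /= /nreg; lia.
  have er : m (ra r) = reg s r by case: rp => _ ->.
  have := bs.1 r => hr.
  eexists; split.
  + rewrite /= istep_const //=; last lia.
    rewrite -/(opI Add) istep_op //= ?upd_eq ?upd_ra // 1?eq_sym // er; lia.
  + by rewrite !upd_eq upd_ra 1?eq_sym //= er.
  + by apply: (frame_upd _ (leqnn d)); [lia | apply: (frame_upd _ (leqnn d)) => //; lia].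
- move: w => /= /and4P[f0 fn sm w].
  have [m1 [r1 e1 fr1]] := IH d m w sz hd hD bs rp.
  have [h1 h2 h3 h4] := rep_frame hd rp fr1.
  have iK := ev_small bs w sm.
  have fM : f * M + M <= W by move: MW; nia.
  have := bs.2 f (ev e s) => aK.
  have [||||m2 [r2 e2 fr2]] := @cAddr_ok f d d.+1 m1 fn h1; rewrite ?e1 //; try lia.
  have e3 : m2 (f * M + ev e s) = arr s f (ev e s).
    by rewrite fr2 ?h3 ?f0 //; rewrite /ra; nia.
  eexists; split.
  + rewrite /= (isteps_catS _ r1) (isteps_catS _ r2) /=.
    by rewrite istep_load // e2 e1 ?e3; lia.
  + by rewrite upd_eq e2 e1.
  + apply: (frame_upd _ (leqnn d)) => [|a]; first by lia.
    by move=> ha; rewrite fr2 ?fr1 //; apply: contraNneq ha => ->; rewrite /tmp /ra; lia.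
- move: w => /= /andP[sm w].
  have [m1 [r1 e1 fr1]] := IH d m w sz hd hD bs rp.
  have [h1 h2 h3 h4] := rep_frame hd rp fr1.
  have iK := ev_small bs w sm; have := IK (ev e s) => vK.
  have e3 : forall v, upd m1 (ra d) v (ev e s).*2 = I (ev e s).
    by move=> v; rewrite upd_neq ?h4 // /ra; lia.
  eexists; split.
  + rewrite /= (isteps_catS _ r1) /= -/(opI Add) istep_op //= e1; last by lia.
    by rewrite istep_load // upd_eq ?addnn ?e3; lia.
  + by rewrite upd_eq upd_eq addnn e3.
  + by apply: (frame_upd _ (leqnn d)); [lia | apply: (frame_upd _ (leqnn d)) => //; lia].
- move: w => /= /andP[wa wb].
  have ga := esz_gt0 a; have gb := esz_gt0 b.
  rewrite /= in sz hD.
  have sa : esz a <= 16 by lia.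
  have sb : esz b <= 16 by lia.
  have da : d + esz a <= 36 by lia.
  have db : d.+1 + esz b <= 36 by lia.
  have [m1 [r1 e1 fr1]] := IHa d m wa sa hd da bs rp.
  have rp1 := rep_frame hd rp fr1.
  have [m2 [r2 e2 fr2]] := IHb d.+1 m1 wb sb (leqW hd) db bs rp1.
  have e3 : m2 (ra d) = ev a s by rewrite fr2 // /tmp /ra; lia.
  eexists; split.
  + rewrite /= (isteps_catS _ r1) (isteps_catS _ r2) /= istep_op // e3 e2 //.
    by apply: (@ev_ltW (EO o a b) s bs) => //=; rewrite wa wb.
  + by rewrite upd_eq e3 e2.
  + apply: (frame_upd _ (leqnn d)) => [|x hx]; first by lia.
    by rewrite fr2 ?fr1 //; apply: contraNN hx; rewrite /tmp /ra; lia.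
Qed.

(* Terminating executions, with their exact number of machine instructions. *)
Inductive bs : cmd -> st -> nat -> st -> Prop :=
| bs_set r e s : ev e s <= K ->
    bs (CSet r e) s (csz (CSet r e)) (set_reg s r (ev e s))
| bs_sto f i e s : ev e s <= K ->
    bs (CSto f i e) s (csz (CSto f i e)) (set_arr s f (ev i s) (ev e s))
| bs_seq c1 c2 s n1 s1 n2 s2 : bs c1 s n1 s1 -> bs c2 s1 n2 s2 ->
    bs (CSeq c1 c2) s (n1 + n2) s2
| bs_when_true e c s n s' : ev e s != 0 -> bs c s n s' ->
    bs (CWhen e c) s (size (cE e nreg) + 1 + n) s'
| bs_when_false e c s : ev e s = 0 ->
    bs (CWhen e c) s (size (cE e nreg) + 1) s
| bs_while_true e c s n1 s1 n2 s2 : ev e s != 0 -> bs c s n1 s1 ->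
    bs (CWhile e c) s1 n2 s2 ->
    bs (CWhile e c) s (size (cE e nreg) + 1 + n1 + 1 + n2) s2
| bs_while_false e c s : ev e s = 0 ->
    bs (CWhile e c) s (size (cE e nreg) + 1) s.

Lemma bounded_set_reg s r x : bounded s -> x <= K -> bounded (set_reg s r x).
Proof. by case=> bR bA hx; split=> //= j; case: eqP. Qed.

Lemma bounded_set_arr s f v x : bounded s -> x <= K -> bounded (set_arr s f v x).
Proof. by case=> bR bA hx; split=> //= f' v'; case: ifP. Qed.

Lemma bs_bounded c s n s' : bs c s n s' -> bounded s -> bounded s'.
Proof.
elim=> //.
- by move=> r e s0 le b; apply: bounded_set_reg.
- by move=> f i e s0 le b; apply: bounded_set_arr.
- by move=> c1 c2 s0 n1 s1 n2 s2 _ h1 _ h2 /h1/h2.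
- by move=> e c0 s0 n1 s1 n2 s2 _ _ h1 _ h2 /h1/h2.
Qed.

Variable P : seq instr.

Lemma jz_ok pc e l m m' s : code_at P pc (cE e nreg ++ [:: IJz (ra nreg) l]) ->
  isteps W (cE e nreg) m = Some m' -> m' (ra nreg) = ev e s ->
  steps W P (size (cE e nreg) + 1) (pc, m) =
    Some (if ev e s == 0 then l else pc + size (cE e nreg) + 1, m').
Proof.
case/code_at_cat=> hc /code_at_cons[hj _] h1 h2.
apply: (steps_trans (steps_isteps hc h1)).
by rewrite /= /step hj /rd raW //= h2 addn1.
Qed.

Lemma rep_set_reg m m' s r x : 0 < r < nreg -> rep m s ->
  (forall a, ~~ tmp nreg a -> m' a = upd m (ra r) x a) -> rep m' (set_reg s r x).
Proof.
move=> hr [h1 h2 h3 h4] fr.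
have nt j : j < nreg -> ~~ tmp nreg (ra j) by rewrite /nreg /tmp /ra; lia.
have r0 : r != 0 by lia.
split=> [|j hj|f v hf hv|y hy].
- by rewrite fr ?nt // upd_ra.
- rewrite fr ?nt //=; last by lia.
  by case: eqP => [->|/eqP ne]; rewrite ?upd_eq // upd_ra 1?eq_sym ?h2.
- rewrite fr ?arr_ntmp //.
  by rewrite upd_neq ?h3 //; move: hr hf M100; rewrite /ra /nreg; nia.
- by rewrite fr ?upd_neq ?h4 /tmp ?odd_double // /ra; lia.
Qed.

Lemma rep_set_arr m m' s f v x : 0 < f < narr -> v <= K -> rep m s ->
  (forall a, ~~ tmp nreg a -> m' a = upd m (f * M + v) x a) -> rep m' (set_arr s f v x).
Proof.
move=> hf hv [h1 h2 h3 h4] fr.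
have nt j : j < nreg -> ~~ tmp nreg (ra j) by rewrite /nreg /tmp /ra; lia.
have lr j : j < nreg -> ra j != f * M + v by move: M100; rewrite /nreg /ra; nia.
split=> [|j hj|f' v' hf' hv'|y hy].
- by rewrite fr ?nt // upd_neq ?lr.
- by rewrite fr ?nt ?upd_neq ?lr ?h2 //; lia.
- rewrite fr ?arr_ntmp //.
  (* An address determines its array and index: since [v <= K < M], division by [M] recovers [f]. *)
  rewrite /upd /= -h3 //; have -> // : (f' * M + v' == f * M + v) = (f' == f) && (v' == v).
  apply/eqP/andP => [e|[/eqP-> /eqP->]] //.
  have lt y : y <= K -> y < M by move=> hy; lia.
  have := congr1 (divn^~ M) e; have M0 : 0 < M by apply: leq_trans M100.
  rewrite /= !divnMDl // !divn_small ?lt // !addn0 => ef.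
  by move: e; rewrite ef => /addnI->.
- by rewrite fr ?upd_neq ?h4 /tmp ?odd_double //; nia.
Qed.

Lemma cC_ok c s n s' : bs c s n s' -> wfC c -> bounded s ->
  forall pc m, code_at P pc (cC c pc) -> rep m s ->
  exists m', steps W P n (pc, m) = Some (pc + csz c, m') /\ rep m' s'.
Proof.
have hK := KltW.
have cE8 e s0 m : wfE e -> esz e <= 16 -> bounded s0 -> rep m s0 ->
    exists m', [/\ isteps W (cE e nreg) m = Some m', m' (ra nreg) = ev e s0,
      rep m' s0 & forall a, ~~ tmp nreg a -> m' a = m a].
  move=> w sz b rp; have [|m' [h1 h2 h3]] := cE_ok w sz (leqnn nreg) _ b rp.
    by rewrite /nreg; lia.
  by exists m'; split=> //; apply: rep_frame rp h3.
elim=> {c s n s'}.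
- move=> r e s le /= /and3P[hr we se] b pc m hc rp.
  have [m1 [r1 e1 rp1 fr1]] := cE8 e s m we se b rp.
  have run1 : isteps W (cC (CSet r e) pc) m =
      Some (upd (upd m1 (ra nreg.+1) 0) (ra r) (ev e s)).
    rewrite /= (isteps_catS _ r1) /= istep_const ?raW //=; last by lia.
    have rr : ra r < W by apply: raW; move: hr; rewrite /nreg; lia.
    have e2 : upd m1 (ra nreg.+1) 0 (ra nreg) = ev e s by rewrite upd_ra.
    have e3 : aopE Add (upd m1 (ra nreg.+1) 0 (ra nreg)) (upd m1 (ra nreg.+1) 0 (ra nreg.+1))
        = ev e s by rewrite e2 upd_eq /= addn0.
    by rewrite -/(opI Add) istep_op // ?raW // ?e3 //; lia.
  exists (upd (upd m1 (ra nreg.+1) 0) (ra r) (ev e s)); split.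
    by have := @steps_isteps W P _ (cC (CSet r e) pc) _ _ hc run1; rewrite size_cC.
  apply: (rep_set_reg hr rp) => a ha.
  rewrite {1}/upd [RHS]/upd; case: eqP => // _.
  by rewrite upd_neq ?fr1 //; apply: contraNneq ha => ->; rewrite /tmp /ra /nreg; lia.
- move=> f i e s le /= /and5P[hf sm wi si /andP[we se]] b pc m hc rp.
  have [m1 [r1 e1 rp1 fr1]] := cE8 i s m wi si b rp.
  have [|m2 [r2 e2 fr2]] := cE_ok we se (leqnSn nreg) _ b rp1.
    by rewrite /nreg; lia.
  have rp2 := rep_frame (leqnSn nreg) rp1 fr2.
  have e3 : m2 (ra nreg) = ev i s by rewrite fr2 // /tmp /ra; lia.
  have iK := ev_small b wi sm.
  have [||||||m3 [r3 e4 fr3]] := @cAddr_ok f nreg nreg.+2 m2; rewrite ?e3 //.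
    by case/andP: hf.
    by case: rp2.
  have e5 : m3 (ra nreg.+1) = ev e s by rewrite fr3.
  have fM : f * M + M <= W by move: MW hf; nia.
  have run1 : isteps W (cC (CSto f i e) pc) m = Some (upd m3 (f * M + ev i s) (ev e s)).
    rewrite /= (isteps_catS _ r1) (isteps_catS _ r2) (isteps_catS _ r3) /=.
    by rewrite istep_store ?e4 ?e3 ?e5 ?raW //; lia.
  exists (upd m3 (f * M + ev i s) (ev e s)); split.
    by have := @steps_isteps W P _ (cC (CSto f i e) pc) _ _ hc run1; rewrite size_cC.
  apply: (rep_set_arr hf iK rp) => a ha.
  have hd j : j < 3 -> a != ra (nreg + j).
    by move=> hj; apply: contraNneq ha => ->; move: hj; rewrite /tmp /ra /nreg; lia.
  rewrite {1}/upd [RHS]/upd; case: eqP => // _.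
  rewrite fr3 ?(hd 0) ?(hd 2) // fr2 ?fr1 //.
  by apply: contraNN ha; rewrite /tmp /ra; lia.
- move=> c1 c2 s n1 s1 n2 s2 h1 IH1 _ IH2 /= /andP[w1 w2] b pc m hc rp.
  case/code_at_cat: hc; rewrite size_cC => hc1 hc2.
  have [m1 [t1 rp1]] := IH1 w1 b pc m hc1 rp.
  have [m2 [t2 rp2]] := IH2 w2 (bs_bounded h1 b) _ _ hc2 rp1.
  by exists m2; rewrite addnA; split=> //; apply: steps_trans t1 t2.
- move=> e c s n s' ne _ IH /= /and3P[we se wc] b pc m hc rp.
  have [m1 [r1 e1 rp1 _]] := cE8 e s m we se b rp.
  have := hc; rewrite /= -cat1s catA => /code_at_cat[hj]; rewrite size_cat addnA => hc'.
  have [m2 [t2 rp2]] := IH wc b _ _ hc' rp1.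
  exists m2; split=> //; have := jz_ok hj r1 e1; rewrite (negbTE ne) => t1.
  by rewrite (steps_trans t1 t2) !addnA.
- move=> e c s e0 /= /and3P[we se wc] b pc m hc rp.
  have [m1 [r1 e1 rp1 _]] := cE8 e s m we se b rp.
  have := hc; rewrite /= -cat1s catA => /code_at_cat[hj _].
  by exists m1; split=> //; have := jz_ok hj r1 e1; rewrite e0 eqxx.
- move=> e c s n1 s1 n2 s2 ne h1 IH1 _ IH2 w b pc m hc rp.
  have := w => /= /and3P[we se wc].
  have [m1 [r1 e1 rp1 _]] := cE8 e s m we se b rp.
  have := hc; rewrite /= -cat1s catA => /code_at_cat[hj]; rewrite size_cat addnA.
  case/code_at_cat=> hc' /code_at_cons[hjmp _].
  have [m2 [t2 rp2]] := IH1 wc b _ _ hc' rp1.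
  have [m3 [t3 rp3]] := IH2 w (bs_bounded h1 b) pc m2 hc rp2.
  exists m3; split=> //; have := jz_ok hj r1 e1; rewrite (negbTE ne) => t1.
  apply: steps_trans t3; apply: steps_trans (steps_trans t1 t2) _.
  by rewrite size_cC in hjmp; rewrite /= /step hjmp.
- move=> e c s e0 /= /and3P[we se wc] b pc m hc rp.
  have [m1 [r1 e1 rp1 _]] := cE8 e s m we se b rp.
  have := hc; rewrite /= -cat1s catA => /code_at_cat[hj _].
  by exists m1; split=> //; have := jz_ok hj r1 e1; rewrite e0 eqxx.
Qed.

(** Meant for loop-free commands; the value on [CWhile] is a dummy, which [safe] rules out. *)
Fixpoint exec (c : cmd) (s : st) : st :=
  match c with
  | CSet r e => set_reg s r (ev e s)
  | CSto f i e => set_arr s f (ev i s) (ev e s)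
  | CSeq c1 c2 => exec c2 (exec c1 s)
  | CWhen e c => if ev e s != 0 then exec c s else s
  | CWhile _ _ => s
  end.

Fixpoint safe (c : cmd) (s : st) : Prop :=
  match c with
  | CSet _ e | CSto _ _ e => ev e s <= K
  | CSeq c1 c2 => safe c1 s /\ safe c2 (exec c1 s)
  | CWhen e c => ev e s != 0 -> safe c s
  | CWhile _ _ => False
  end.

Lemma bs_exec c s : safe c s -> exists2 n, n <= csz c & bs c s n (exec c s).
Proof.
elim: c s => [r e|f i e|c1 IH1 c2 IH2|e c IH|e c IH] s //=.
- by move=> h; exists (csz (CSet r e)) => //; apply: bs_set.
- by move=> h; exists (csz (CSto f i e)) => //; apply: bs_sto.
- case=> /IH1[n1 l1 h1] /IH2[n2 l2 h2]; exists (n1 + n2); first exact: leq_add.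
  exact: bs_seq h1 h2.
- case: eqP => [e0 _|/eqP ne /(_ isT)/IH[n le h]].
    by exists (size (cE e nreg) + 1); [rewrite leq_addr | apply: bs_when_false].
  by exists (size (cE e nreg) + 1 + n); [rewrite leq_add2l | apply: bs_when_true].
Qed.

(* [i] bounds the number of remaining iterations. *)
Lemma bs_while (J : nat -> st -> Prop) e c T : 
  (forall i s, J i s -> ev e s != 0 -> exists n s', [/\ 0 < i, n <= T, bs c s n s' & J i.-1 s']) ->
  forall i s, J i s -> exists n s' j,
    [/\ n <= i.+1 * (size (cE e nreg) + 2 + T), bs (CWhile e c) s n s', J j s' & ev e s' = 0].
Proof using Type.
clear KW MW M100 KM IK K4.
move=> step; elim=> [|i IH] s hJ; (case E: (ev e s == 0);
  first by exists (size (cE e nreg) + 1), s; eexists; split;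
    [lia | apply: bs_while_false; apply/eqP | exact: hJ | apply/eqP]).
- by have [n [s' []]] := step _ _ hJ (negbT E).
- have [n1 [s1 [_ l1 b1 h1]]] := step _ _ hJ (negbT E).
  have [n2 [s2 [j [l2 b2 h2 e2]]]] := IH _ h1.
  exists (size (cE e nreg) + 1 + n1 + 1 + n2), s2, j; split=> //; first by nia.
  exact: bs_while_true (negbT E) b1 b2.
Qed.

End Sim.

(** * Nodes, tops and components *)

Lemma size_paths t : size (paths t) = bsize t.
Proof. by elim: t => //= l <- r <-; rewrite size_cat !size_map. Qed.

Lemma bsize_nleaves t : (bsize t).+1 = 2 * nleaves t.
Proof. by elim: t => //= l hl r hr; lia. Qed.

Lemma bsize_gt0 t : 0 < bsize t. Proof. by case: t. Qed.

Lemma cons_inj b : injective (cons b : seq bool -> seq bool).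
Proof. by move=> p q []. Qed.

Lemma mem_paths_cons l r b p :
  (b :: p \in paths (BNode l r)) = (p \in paths (if b then r else l)).
Proof.
have mem_neq b' s : b != b' -> (b :: p \in map (cons b') s) = false.
  by move=> ne; apply/mapP=> -[q _ [e _]]; rewrite e eqxx in ne.
rewrite /= inE mem_cat /=; case: b mem_neq => h.
  by rewrite h // (mem_map (@cons_inj true)).
by rewrite (mem_map (@cons_inj false)) h ?orbF.
Qed.

Lemma uniq_paths t : uniq (paths t).
Proof.
elim: t => //= l ul r ur; rewrite cat_uniq !map_inj_uniq ?ul ?ur //; try exact: cons_inj.
have nn b s : [::] \notin [seq b :: i | i <- s] by apply/mapP=> -[].
rewrite mem_cat !(negbTE (nn _ _ _)) andbT /=.
by apply/hasPn => p /mapP[q _ ->]; apply/mapP=> -[].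
Qed.

Lemma nil_paths t : [::] \in paths t. Proof. by case: t. Qed.

Lemma index_nil_paths t : index [::] (paths t) = 0. Proof. by case: t. Qed.

Lemma paths_prefix t p q : prefix p q -> q \in paths t -> p \in paths t.
Proof.
elim: t p q => [|l IHl r IHr] [|a p] [|b q] //=; try by rewrite nil_paths.
case/andP=> /eqP<- pq; rewrite -!/(paths (BNode l r)) !mem_paths_cons.
by case: a; [apply: IHr | apply: IHl].
Qed.

Lemma paths_sibling t p b : rcons p b \in paths t -> rcons p (~~ b) \in paths t.
Proof.
elim: t p b => [|l IHl r IHr] [|a p] b //=.
  by case: b; rewrite -!/(paths (BNode l r)) !mem_paths_cons !nil_paths.
by rewrite -!/(paths (BNode l r)) !mem_paths_cons; case: a; [apply: IHr | apply: IHl].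
Qed.

Lemma index_paths_cons l r b p : p \in paths (if b then r else l) ->
  index (b :: p) (paths (BNode l r)) =
    (b * bsize l + index p (paths (if b then r else l))).+1.
Proof.
case: b => pin /=; rewrite index_cat.
  rewrite (index_map (@cons_inj true)) size_map size_paths mul1n ifF //.
  by apply/mapP=> -[].
by rewrite mem_map ?pin ?(index_map (@cons_inj false)) //; exact: cons_inj.
Qed.

#[local] Arguments paths : simpl never.

Lemma index_left_child t p : rcons p false \in paths t ->
  index (rcons p false) (paths t) = (index p (paths t)).+1.
Proof.
elim: t p => [|l IHl r IHr] p; first by rewrite inE; case: p.
case: p => [|a p] h; first by rewrite [rcons _ _]/= index_paths_cons ?nil_paths // !index_nil_paths.
move: h; rewrite !rcons_cons mem_paths_cons => h.
have h' := paths_prefix (prefix_rcons _ _) h.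
rewrite !index_paths_cons //.
by case: a h {h'} => [/IHr|/IHl] ->; rewrite addnS.
Qed.

Lemma index_child_gt t p b : rcons p b \in paths t ->
  index p (paths t) < index (rcons p b) (paths t).
Proof.
elim: t p => [|l IHl r IHr] p; first by rewrite inE; case: p.
case: p => [|a p] h.
  move: h; rewrite [rcons _ _]/= mem_paths_cons => h.
  by rewrite index_paths_cons // index_nil_paths.
move: h; rewrite !rcons_cons mem_paths_cons => h.
have h' := paths_prefix (prefix_rcons _ _) h.
rewrite !index_paths_cons // ltnS ltn_add2l.
by case: a h {h'} => [/IHr|/IHl].
Qed.

(** * Ancestors, tops and connectivity *)

Section Nodes.
Variable T : btree.
Local Notation node := 'I_(bsize T).
Implicit Types (x y z : node) (A B : {set node}).

Lemma addr_in x : addr x \in paths T.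
Proof. by rewrite mem_nth ?size_paths. Qed.

Lemma index_addr x : index (addr x) (paths T) = x.
Proof. by rewrite index_uniq ?size_paths ?uniq_paths. Qed.

Lemma addr_inj : injective (@addr T).
Proof. by move=> x y e; apply/val_inj; rewrite /= -index_addr e index_addr. Qed.

Lemma addr_ex p : p \in paths T -> exists x, addr x = p.
Proof.
move=> hp; have hi : index p (paths T) < bsize T by rewrite -size_paths index_mem.
by exists (Ordinal hi); rewrite /addr nth_index.
Qed.

Definition anc x y := prefix (addr x) (addr y).

Lemma anc_refl x : anc x x. Proof. exact: prefix_refl. Qed.

Lemma anc_trans x y z : anc x y -> anc y z -> anc x z.
Proof. exact: prefix_trans. Qed.

Lemma anc_size x y : anc x y -> size (addr x) <= size (addr y).
Proof. by case/prefixP=> u ->; rewrite size_cat leq_addr. Qed.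

Lemma anc_anti x y : anc x y -> anc y x -> x = y.
Proof.
move=> xy yx; have := anc_size xy; have := anc_size yx.
case/prefixP: xy => u e; rewrite e size_cat => h1 h2.
by apply: addr_inj; rewrite e; case: u h1 {e h2} => [|? ?] /=; rewrite ?cats0 //; lia.
Qed.

Lemma anc_comparable x y z : anc x z -> anc y z -> anc x y \/ anc y x.
Proof.
rewrite /anc !prefixE => /eqP hx /eqP hy.
case: (leqP (size (addr x)) (size (addr y))) => h; [left|right]; apply/eqP.
  by rewrite -hy take_takel ?hx.
by rewrite -hx take_takel ?hy // ltnW.
Qed.

Lemma parentOfP x y : reflect (exists b, addr y = rcons (addr x) b) (parentOf x y).
Proof.
apply: (iffP andP) => [[/eqP hs /eqP ht]|[b ->]].
  case/lastP: (addr y) hs ht => [//|q b]; rewrite size_rcons => -[hs].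
  by rewrite -cats1 take_cat -hs ltnn subnn take0 cats0 => ->; exists b; rewrite cats1.
by rewrite size_rcons -cats1 take_size_cat.
Qed.

Lemma parentOf_inj x x' y : parentOf x y -> parentOf x' y -> x = x'.
Proof.
by move=> /parentOfP[b e] /parentOfP[b']; rewrite e => /rcons_inj[/addr_inj].
Qed.

Lemma parentOf_lt x y : parentOf x y -> x < y.
Proof.
case/parentOfP=> b e; rewrite -[x : nat]index_addr -[y : nat]index_addr e.
by apply: index_child_gt; rewrite -e addr_in.
Qed.

Lemma parentOf_anc x y : parentOf x y -> anc x y.
Proof. by case/parentOfP=> b; rewrite /anc => ->; apply: prefix_rcons. Qed.

Lemma parentOf_neq x y : parentOf x y -> x != y.
Proof. by move/parentOf_lt => h; apply: contraTneq h => ->; rewrite ltnn. Qed.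

Lemma parentOf_nanc x y : parentOf x y -> ~~ anc y x.
Proof.
move=> xy; apply/negP=> yx; have := parentOf_lt xy.
by rewrite (anc_anti yx (parentOf_anc xy)) ltnn.
Qed.

Lemma anc_le x y : anc x y -> x = y \/ exists2 p, parentOf p y & anc x p.
Proof.
case/prefixP=> u; case/lastP: u => [|u b] e; first by left; apply: addr_inj; rewrite e cats0.
have [|p ep] := @addr_ex (addr x ++ u).
  by apply: paths_prefix (addr_in y); rewrite e -rcons_cat prefix_rcons.
right; exists p; first by apply/parentOfP; exists b; rewrite e ep rcons_cat.
by rewrite /anc ep prefix_prefix.
Qed.

Lemma anc_parent x y p : anc x y -> x != y -> parentOf p y -> anc x p.
Proof.
move=> xy ne py; case: (anc_le xy) ne => [->|[q qy xq] _]; first by rewrite eqxx.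
by rewrite (parentOf_inj py qy).
Qed.

Lemma anc_child x y : anc x y -> x != y -> exists2 c, parentOf x c & anc c y.
Proof.
case/prefixP=> -[|b u] e ne.
  by move: ne; rewrite (addr_inj (etrans (esym (cats0 _)) (esym e))) eqxx.
have [|c ec] := @addr_ex (rcons (addr x) b).
  by apply: paths_prefix (addr_in y); rewrite e -cat_rcons prefix_prefix.
exists c; first by apply/parentOfP; exists b.
by rewrite /anc ec e -cat_rcons prefix_prefix.
Qed.

Lemma node_ind (Q : node -> Prop) :
  (forall y, (forall x, x < y -> Q x) -> Q y) -> forall y, Q y.
Proof.
move=> IH y; have [n le_n] := ubnP (y : nat); elim: n y le_n => // n IHn y le_n.
by apply: IH => x lt_xy; apply: IHn; apply: leq_trans lt_xy _.
Qed.

Lemma anc_leq x y : anc x y -> x <= y.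
Proof.
elim/node_ind: y => y IH xy; case: (anc_le xy) => [-> //|[p py xp]].
by apply: leq_trans (IH _ (parentOf_lt py) xp) (ltnW (parentOf_lt py)).
Qed.

Lemma childOfP b x y : reflect (childOf b x = Some y) (addr y == rcons (addr x) b).
Proof.
apply: (iffP eqP); rewrite /childOf; case: pickP => [z /eqP hz|h].
- by move=> hy; congr Some; apply: addr_inj; rewrite hy hz.
- by move=> hy; have := h y; rewrite hy eqxx.
- by case=> <-.
- by [].
Qed.

Lemma childOf_parent b x y : childOf b x = Some y -> parentOf x y.
Proof. by move/childOfP/eqP=> e; apply/parentOfP; exists b. Qed.

Lemma parent_childOf x y : parentOf x y -> exists b, childOf b x = Some y.
Proof. by case/parentOfP=> b e; exists b; apply/childOfP/eqP. Qed.

Lemma childOf_inj b b' x x' y :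
  childOf b x = Some y -> childOf b' x' = Some y -> b = b' /\ x = x'.
Proof.
by move=> /childOfP/eqP e /childOfP/eqP; rewrite e => /rcons_inj[/addr_inj -> ->].
Qed.

Lemma parentNodeP x y : reflect (parentNode y = Some x) (parentOf x y).
Proof.
apply: (iffP idP); rewrite /parentNode; case: pickP => [z hz|h].
- by move=> xy; rewrite (parentOf_inj xy hz).
- by move=> xy; have := h x; rewrite xy.
- by case=> <-.
- by [].
Qed.

Definition up A y := if parentNode y is Some p then if p \in A then p else y else y.

(* The highest node reached from [y] by moving to parents in [A]. *)
Definition top A y := iter (size (addr y)) (up A) y.

Lemma top_par A x y : parentOf x y -> x \in A -> top A y = top A x.
Proof.
move=> xy xA; have [b e] := parentOfP _ _ xy.
by rewrite /top e size_rcons iterSr /up (parentNodeP _ _ xy) xA.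
Qed.

Lemma top_self A y : (forall x, parentOf x y -> x \notin A) -> top A y = y.
Proof.
move=> h; apply: iter_fix; rewrite /up.
by case E: (parentNode y) => [p|] //; move/parentNodeP/h/negbTE: E => ->.
Qed.

Variant top_spec A y : node -> Prop :=
| TopPar x of parentOf x y & x \in A : top_spec A y (top A x)
| TopSelf of (forall x, parentOf x y -> x \notin A) : top_spec A y y.

Lemma topP A y : top_spec A y (top A y).
Proof.
case E: (parentNode y) => [x|].
  move/parentNodeP: E => xy; case xA: (x \in A).
    by rewrite (top_par xy xA); apply: TopPar xy xA.
  have h z : parentOf z y -> z \notin A by move=> zy; rewrite (parentOf_inj zy xy) xA.
  by rewrite (top_self h); apply: TopSelf.
have h z : parentOf z y -> z \notin A by move/parentNodeP; rewrite E.
by rewrite (top_self h); apply: TopSelf.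
Qed.

Lemma top_anc A y : anc (top A y) y.
Proof.
elim/node_ind: y => y IH; case: topP => [x xy xA|_]; last exact: anc_refl.
exact: anc_trans (IH _ (parentOf_lt xy)) (parentOf_anc xy).
Qed.

Lemma top_in A y : y \in A -> top A y \in A.
Proof.
elim/node_ind: y => y IH yA; case: topP => // x xy xA.
exact: IH (parentOf_lt xy) xA.
Qed.

Lemma top_notin A x y : parentOf x (top A y) -> x \notin A.
Proof.
elim/node_ind: y x => y IH x; case: topP => [z zy zA|]; last by apply.
exact: IH (parentOf_lt zy) _.
Qed.

Lemma top_top A y : top A (top A y) = top A y.
Proof. by apply: top_self => x; apply: top_notin. Qed.

Lemma top_between A y z : y \in A -> anc (top A y) z -> anc z y ->
  z \in A /\ top A z = top A y.
Proof.
elim/node_ind: y => y IH yA tz zy; have [->//|ne] := eqVneq z y.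
case: topP tz => [x xy xA|_] tz; last by rewrite (anc_anti tz zy) eqxx in ne.
exact: IH (parentOf_lt xy) xA tz (anc_parent zy ne xy).
Qed.

Lemma convex A x y z : y \in A -> top A x = top A y -> anc x z -> anc z y ->
  z \in A /\ top A z = top A x.
Proof.
move=> yA e xz zy; rewrite e; apply: top_between yA _ zy.
by rewrite -e; apply: anc_trans (top_anc A x) xz.
Qed.

Lemma top_eq A c y : (forall x, parentOf x c -> x \notin A) -> anc c y ->
  (forall z, anc c z -> anc z y -> z != y -> z \in A) -> top A y = c.
Proof.
elim/node_ind: y => y IH hc cy bt; case: (anc_le cy) => [<-|[p py cp]].
  exact: top_self.
have pA : p \in A by apply: bt (parentOf_anc py) (parentOf_neq py).
rewrite (top_par py pA); apply: IH (parentOf_lt py) hc cp _ => z cz zp _.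
apply: bt cz (anc_trans zp (parentOf_anc py)) _.
by apply: contraNneq (parentOf_nanc py) => <-.
Qed.

Lemma top_mono A B y : A \subset B -> top B (top A y) = top B y.
Proof.
move=> sAB; elim/node_ind: y => y IH; case: (topP A y) => // x xy xA.
by rewrite (IH _ (parentOf_lt xy)) (top_par xy) // (subsetP sAB).
Qed.

Lemma restr_sym A : symmetric (restr A).
Proof. by move=> x y; rewrite /restr /= /adj; do 2!case: (_ \in A) => //=; rewrite orbC. Qed.

Lemma connect_top A y : y \in A -> connect (restr A) y (top A y).
Proof.
elim/node_ind: y => y IH yA; case: topP => // x xy xA.
apply: connect_trans (IH _ (parentOf_lt xy) xA); apply: connect1.
by rewrite /restr /= /adj yA xA xy orbT.
Qed.

Lemma restr_top A x y : restr A x y -> top A x = top A y.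
Proof.
by case/and3P=> xA yA /orP[] h; [rewrite (top_par h xA) | rewrite (top_par h yA)].
Qed.

(** Edges inside [A] preserve [top A], and every node of [A] is connected to its top, so tops are
    canonical representatives of the components. *)
Lemma compoE A x y : (y \in compo A x) = [&& x \in A, y \in A & top A y == top A x].
Proof.
rewrite inE; case xA: (x \in A) => //=; apply/idP/andP => [|[yA /eqP e]].
  move=> xy; pose a := [pred z | (z \in A) && (top A z == top A x)].
  have cl : closed (restr A) a.
    move=> u v uv; rewrite !inE (restr_top uv).
    by case/and3P: uv => -> -> _.
  by have := closed_connect cl xy; rewrite !inE xA eqxx => /esym/andP.
apply: connect_trans (connect_top xA) _; rewrite -e.
by rewrite (sym_connect_sym (@restr_sym A)) connect_top.
Qed.

Lemma compo_sub_closed (Z Y : {set node}) y : Z \subset Y -> y \in Z ->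
  (forall u v, u \in Z -> v \in Y -> adj u v -> v \in Z) -> compo Y y = compo Z y.
Proof.
move=> sZY yZ cl; apply/setP=> z; rewrite !inE yZ (subsetP sZY) //=.
apply/idP/idP.
  case/connectP=> p pp ->; apply/connectP; exists p => //.
  elim: p y yZ pp => //= v p IH y yZ /andP[/and3P[yY vY yv] pp].
  have vZ := cl _ _ yZ vY yv.
  by rewrite /restr /= yZ vZ yv /=; apply: IH.
apply: connect_sub => u v /and3P[uZ vZ uv]; apply: connect1.
by rewrite /restr /= !(subsetP sZY).
Qed.

(** The edge above [d], the only one leaving the subtree of [d], is absent from [Z], so a component
    lies wholly inside or wholly outside that subtree. *)
Lemma compo_anc (Z : {set node}) d y z :
  (forall p, parentOf p d -> p \in Z -> d \notin Z) ->
  z \in compo Z y -> anc d z = anc d y.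
Proof.
move=> hd; rewrite inE => /andP[yZ yz].
pose a := [pred z | anc d z].
suff cl : closed (restr Z) a by have := closed_connect cl yz; rewrite !inE => ->.
suff step u v : u \in Z -> v \in Z -> parentOf u v -> anc d u = anc d v.
  by move=> u v /and3P[uZ vZ /orP[] h]; rewrite !inE; [|symmetry]; apply: step.
move=> uZ vZ uv; apply/idP/idP => [du|dv]; first exact: anc_trans du (parentOf_anc uv).
apply: anc_parent dv _ (uv); apply: contraTneq uv => e.
by apply/negP=> uv; move: (hd u); rewrite e uv vZ => /(_ isT uZ).
Qed.

End Nodes.

(** * Splitting nodes *)

Section Round.
Variable T : btree.
Local Notation node := 'I_(bsize T).
Implicit Types (x y z c s t : node) (A B : {set node}).

Definition sub A x := [set y in A | [&& x \in A, top A y == top A x & anc x y]].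
Definition szm A x := #|sub A x|.
(* For [x] in [A] this says that an edge from below lies under [x] in its component. *)
Definition xm A x := [exists z, (z \notin A) && anc x z].

(** An absent child contributes 0, just like the dummy entry 0 of an array. *)
Definition omap0 (f : node -> nat) (o : option node) := if o is Some c then f c else 0.

Lemma in_sub A x y :
  (y \in sub A x) = [&& y \in A, x \in A, top A y == top A x & anc x y].
Proof. by rewrite !inE. Qed.

Lemma sub_refl A x : x \in A -> x \in sub A x.
Proof. by move=> xA; rewrite in_sub xA eqxx anc_refl. Qed.

Lemma szm_notin A x : x \notin A -> szm A x = 0.
Proof.
by move=> h; apply/eqP; rewrite cards_eq0; apply/eqP/setP=> y; rewrite in_sub (negbTE h) inE andbF.
Qed.

Lemma szm_le A x : szm A x <= bsize T.
Proof. by apply: leq_trans (max_card _) _; rewrite card_ord. Qed.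

Lemma sub_in A x y : y \in A -> x \in A -> top A y = top A x -> anc x y -> y \in sub A x.
Proof. by move=> h1 h2 /eqP h3 h4; rewrite in_sub h1 h2 h3. Qed.

Lemma sub_mono A x y : x \in A -> y \in A -> top A x = top A y -> anc x y ->
  sub A y \subset sub A x.
Proof.
move=> xA yA e xy; apply/subsetP=> z; rewrite !in_sub => /and4P[zA _ /eqP ez yz].
by rewrite zA xA ez e eqxx (anc_trans xy yz).
Qed.

Lemma szm_rec A x : x \in A ->
  szm A x = (omap0 (szm A) (childOf false x) + omap0 (szm A) (childOf true x)).+1.
Proof.
move=> xA; pose so b := if childOf b x is Some c then sub A c else set0.
have soE b : omap0 (szm A) (childOf b x) = #|so b|.
  by rewrite /so; case: childOf => //=; rewrite cards0.
have in_so b y : (y \in so b) = [&& y \in sub A x, y != x & 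
    (if childOf b x is Some c then anc c y else false)].
  rewrite /so; case E: childOf => [c|]; last by rewrite inE !andbF.
  have xc := childOf_parent E; have tc := top_par xc xA.
  rewrite !in_sub xA; apply/and4P/and3P => [[yA cA /eqP e cy]|[/and4P[yA _ /eqP e xy] ne cy]].
    have xy := anc_trans (parentOf_anc xc) cy.
    split=> //; first by rewrite yA e tc eqxx xy.
    by apply: contraTneq cy => ->; apply: parentOf_nanc.
  have [cA _] := convex yA (esym e) (parentOf_anc xc) cy.
  by split=> //; rewrite e tc.
rewrite !soE /szm (cardsD1 x) sub_refl //= add1n; congr _.+1.
have -> : sub A x :\ x = so false :|: so true.
  apply/setP=> y; rewrite in_setD1 in_setU !in_so.
  case: eqP => //= /eqP ne; rewrite ?andbF //; apply/idP/orP => [yx|[] /andP[] //].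
  have xy : anc x y by move: yx; rewrite in_sub => /and4P[].
  have [c xc cy] := anc_child xy (introN eqP (fun e => negP ne (introT eqP (esym e)))).
  have [b eb] := parent_childOf xc.
  by case: b eb => eb; [right|left]; rewrite yx eb.
rewrite cardsU; set i := #|_ :&: _|; suff -> : i = 0 by rewrite subn0.
apply/eqP; rewrite cards_eq0 -subset0; apply/subsetP=> y; rewrite inE !in_so.
case E0: childOf => [c|]; last by rewrite !andbF.
case E1: childOf => [d|]; last by rewrite !andbF.
case/andP=> /and3P[_ _ cy] /and3P[_ _ dy].
have /childOfP/eqP e0 := E0; have /childOfP/eqP e1 := E1.
have : c = d.
  have sz : size (addr c) = size (addr d) by rewrite e0 e1 !size_rcons.
  by apply: addr_inj; move: cy dy; rewrite /anc !prefixE sz => /eqP <- /eqP.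
by move=> ecd; have := childOf_inj E0 (etrans E1 (congr1 Some (esym ecd))) => -[].
Qed.

Lemma xm_rec A x : xm A x =
  (0 < (x \notin A) + omap0 (fun c => xm A c) (childOf false x)
                    + omap0 (fun c => xm A c) (childOf true x)).
Proof.
have xmc c : parentOf x c -> xm A c -> xm A x.
  move=> xc /existsP[z /andP[zA cz]]; apply/existsP; exists z.
  by rewrite zA (anc_trans (parentOf_anc xc) cz).
rewrite !addn_gt0; apply/idP/idP => [/existsP[z /andP[zA xz]]|].
  have [e|ne] := eqVneq x z; first by rewrite e zA.
  have [c xc cz] := anc_child xz ne.
  have [b eb] := parent_childOf xc.
  have h : xm A c by apply/existsP; exists z; rewrite zA.
  by case: b eb => ->; rewrite /= h ?orbT.
case/orP => [/orP[]|].
- by case xA: (x \in A) => // _; apply/existsP; exists x; rewrite xA anc_refl.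
- by case E: childOf => [c|] //=; case h: (xm A c) => // _; apply: xmc h; apply: childOf_parent E.
- by case E: childOf => [c|] //=; case h: (xm A c) => // _; apply: xmc h; apply: childOf_parent E.
Qed.

Lemma compo_top A x : x \in A -> compo A x = sub A (top A x).
Proof.
move=> xA; apply/setP=> y; rewrite compoE in_sub xA top_in // top_top /=.
case yA: (y \in A) => //=; case: eqP => //= <-; by rewrite top_anc.
Qed.

Lemma card_compo A x : x \in A -> #|compo A x| = szm A (top A x).
Proof. by move=> xA; rewrite compo_top. Qed.

(* The heavy nodes of a component form a path from its top to a centroid, and the good
   ones an initial segment of that path, which ends at the lowest common ancestor of the
   centroid and the node with a removed child (at the centroid if there is none). *)
Definition heavy A x := (x \in A) && (szm A (top A x) < 2 * szm A x).
Definition good A x := heavy A x && (xm A (top A x) <= xm A x).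
Definition splitter A x := good A x && [forall c, parentOf x c ==> ~~ good A c].

(** Two subsets of a component that each contain more than half of it share a node, and ancestors of
    one node are comparable. *)
Lemma heavy_comparable A x y : heavy A x -> heavy A y -> top A x = top A y ->
  anc x y \/ anc y x.
Proof.
case/andP=> xA hx /andP[yA hy] e.
have lt0 : 0 < #|sub A x :&: sub A y|.
  have := cardsUI (sub A x) (sub A y).
  have : #|sub A x :|: sub A y| <= szm A (top A x).
    rewrite /szm -compo_top // subset_leq_card //; apply/subsetP=> z.
    by rewrite inE !in_sub compoE xA => /orP[] /and4P[-> _ /eqP-> _]; rewrite ?e eqxx.
  by move: hx hy; rewrite -e /szm; lia.
case/card_gt0P: lt0 => z; rewrite inE !in_sub => /andP[/and4P[_ _ _ xz] /and4P[_ _ _ yz]].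
exact: anc_comparable xz yz.
Qed.

Lemma heavy_child A x y c : x \in A -> heavy A y -> top A x = top A y ->
  parentOf x c -> anc c y -> heavy A c /\ top A c = top A x.
Proof.
move=> xA /andP[yA hy] e xc cy.
have [cA ec] := convex yA e (parentOf_anc xc) cy; split=> //.
rewrite /heavy cA ec e; apply: leq_trans hy _.
by rewrite leq_mul2l /= subset_leq_card // sub_mono // ec e.
Qed.

Lemma good_child A x y c : x \in A -> good A y -> top A x = top A y ->
  parentOf x c -> anc c y -> good A c.
Proof.
move=> xA /andP[hy xy] e xc cy.
have [hc ec] := heavy_child xA hy e xc cy; rewrite /good hc ec e.
apply: leq_trans xy _; case h: (xm A y) => //.
case/existsP: h => z /andP[zA yz].
suff -> : xm A c by [].
by apply/existsP; exists z; rewrite zA (anc_trans cy yz).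
Qed.

Lemma good_in A x : good A x -> x \in A.
Proof. by case/andP=> /andP[]. Qed.

Lemma split_good A x : splitter A x -> good A x. Proof. by case/andP. Qed.

Lemma split_heavy A x : splitter A x -> heavy A x.
Proof. by case/andP=> /andP[]. Qed.

Lemma split_in A x : splitter A x -> x \in A. Proof. by move/split_good/good_in. Qed.

Lemma split_child A s c : splitter A s -> parentOf s c -> ~~ good A c.
Proof. by case/andP=> _ /forallP/(_ c)/implyP. Qed.

(** The top is always good, and the good node with the largest preorder number has no good child,
    since children have larger numbers. *)
Lemma split_ex A x : x \in A -> exists2 s, splitter A s & top A s = top A x.
Proof.
move=> xA; pose Q y := good A y && (top A y == top A x).
have Qt : Q (top A x).
  rewrite /Q /good /heavy !top_top top_in // leqnn eqxx !andbT.
  have : 0 < szm A (top A x) by apply/card_gt0P; exists (top A x); rewrite sub_refl ?top_in.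
  by lia.
case: (arg_maxnP (fun y : node => y : nat) Qt) => s /andP[gs /eqP es] max_s.
exists s => //; rewrite /splitter gs; apply/forallP=> c; apply/implyP=> sc.
apply/negP=> gc; suff /max_s : Q c by rewrite /= leqNgt (parentOf_lt sc).
by rewrite /Q gc (top_par sc) ?es ?eqxx // good_in.
Qed.

(** Good nodes of a component lie on one path; if [s] were strictly above [s'], its child towards
    [s'] would be good. *)
Lemma split_uniq A s s' : splitter A s -> splitter A s' -> top A s = top A s' -> s = s'.
Proof.
wlog: s s' / anc s s' => [H|ss' sps sps' e].
  move=> sps sps' e.
  have [h|h] := heavy_comparable (split_heavy sps) (split_heavy sps') e.
    exact: H.
  by apply/esym/H.
apply: contraTeq isT => ne; have [c sc cs'] := anc_child ss' ne.
by have := split_child sps sc; rewrite (good_child (split_in sps) (split_good sps') e sc cs').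
Qed.

(** Climb from [w], skipping removed nodes. A component met on the way that does not contain [i] is
    left through the removed parent of its top; the climb ends in the component of [i]. *)
Lemma below_edge A i w : i \in A -> w \notin A -> anc i w ->
  exists x y, [/\ x \in A, top A x = top A i, y \notin A, parentOf x y & anc i x].
Proof.
move=> iA; elim/node_ind: w => w IH wA iw.
case: (anc_le iw) => [e|[p pw ip]]; first by rewrite -e iA in wA.
case pA: (p \in A); last by apply: IH (parentOf_lt pw) (negbT pA) ip.
case: (anc_comparable ip (top_anc A p)) => h; last first.
  have [_ e] := top_between pA h ip.
  by exists p, w.
case: (anc_le h) => [e|[q qt iq]].
  by exists p, w; split=> //; rewrite e top_top.
apply: (IH q) iq; last exact: top_notin qt.
apply: ltn_trans (parentOf_lt pw); apply: leq_trans (parentOf_lt qt) _.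
exact: anc_leq (top_anc A p).
Qed.

(** [split_ok] demands a unique edge from below; this is the form in which the rounds preserve
    uniqueness. *)
Definition one_below A := forall x x' y y', x \in A -> x' \in A -> top A x = top A x' ->
  y \notin A -> y' \notin A -> parentOf x y -> parentOf x' y' -> x = x' /\ y = y'.

Lemma lcp_cat (p u v : seq bool) : lcp (p ++ u) (p ++ v) = p ++ lcp u v.
Proof. by elim: p => //= a p ->; rewrite eqxx. Qed.

(** A piece below [x] lies under a child that is not heavy; the piece above avoids [sub A x], which
    is more than half of the component. *)
Lemma centroid_heavy A x : heavy A x -> (forall c, parentOf x c -> ~~ heavy A c) ->
  centroid (compo A x) x.
Proof.
move=> /andP[xA hx] hc; rewrite /centroid compoE xA eqxx /=.
apply/forallP=> y; apply/implyP; rewrite in_setD1 => /andP[yx yD].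
have := yD; rewrite compoE => /and3P[_ yA /eqP ey]; rewrite (card_compo xA).
set Z := compo A x :\ x; have sZ z : z \in compo Z y -> z \in compo A x.
  by rewrite compoE => /and3P[_]; rewrite in_setD1 => /andP[].
case xy: (anc x y).
  have [c xc cy] := anc_child xy (introN eqP (fun e => negP yx (introT eqP (esym e)))).
  have [cA ec] := convex yA (esym ey) (parentOf_anc xc) cy.
  have := hc c xc; rewrite /heavy cA ec -leqNgt => h; apply: leq_trans h.
  rewrite leq_mul2l /= subset_leq_card //; apply/subsetP=> z hz.
  have := sZ z hz; rewrite compoE => /and3P[_ zA /eqP ez].
  apply: sub_in => //; first by rewrite ec.
  rewrite (compo_anc _ hz) // => p pc.
  by rewrite -(parentOf_inj xc pc) in_setD1 eqxx.
have : compo Z y \subset sub A (top A x) :\: sub A x.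
  apply/subsetP=> z hz; rewrite in_setD -compo_top // sZ // andbT in_sub.
  rewrite (_ : anc x z = false) ?andbF // -xy; apply: compo_anc hz => p px _.
  by rewrite in_setD1 eqxx.
move/subset_leq_card; rewrite cardsDS.
  rewrite -/(szm A (top A x)) -/(szm A x); move: hx.
  by move: (szm A x) (szm A _) #|compo Z y| => a b d; lia.
by apply: sub_mono => //; rewrite ?top_in ?top_top ?top_anc.
Qed.

Lemma split_okP A s : one_below A -> splitter A s -> split_ok (compo A s) s.
Proof.
move=> ob sps; have sA := split_in sps; have /andP[hs xs] := split_good sps.
have inD z : (z \in compo A s) = (z \in A) && (top A z == top A s) by rewrite compoE sA.
have fbP x y : reflect [/\ x \in A, top A x = top A s, y \notin A & parentOf x y]
                       (from_below (compo A s) x y).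
  apply: (iffP and3P); rewrite !inD.
    case=> /andP[xA /eqP ex] yD xy; split=> //; apply: contraNN yD => yA.
    by rewrite yA (top_par xy xA) ex eqxx.
  by case=> xA ex yA xy; rewrite xA ex eqxx (negbTE yA).
case xt: (xm A (top A s)); last first.
  left; split=> [x y|].
    apply/negP=> /fbP[xA ex yA xy]; suff : xm A (top A s) by rewrite xt.
    apply/existsP; exists y.
    by rewrite yA -ex (anc_trans (top_anc A x) (parentOf_anc xy)).
  (* No removed node lies below the top, so good means heavy and the lowest good node is a
     centroid. *)
  apply: centroid_heavy => // c sc; have := split_child sps sc; rewrite /good negb_and.
  case/orP=> // /negP[]; case cA: (c \in A); last first.
    suff : xm A c by case: xm => // _; case: xm.
    by apply/existsP; exists c; rewrite cA anc_refl.
  by rewrite (top_par sc sA) xt.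
right; rewrite xt in xs.
have /existsP[w /andP[wA sw]] : xm A s by case: xm xs.
have [x [y [xA ex yA xy sx]]] := below_edge sA wA sw.
exists x, y; split; first exact/fbP.
split=> [x' y' /fbP[xA' ex' yA' xy']|].
  by have [] := ob x' x y' y xA' xA (etrans ex' (esym ex)) yA' yA xy' xy.
(* The centroid is the lowest heavy node, found as the one with the largest preorder number. *)
pose Q c := heavy A c && (top A c == top A s).
have Qs : Q s by rewrite /Q hs eqxx.
case: (arg_maxnP (fun y : node => y : nat) Qs) => c /andP[hc /eqP ec] max_c.
have cA : c \in A by case/andP: hc.
have hcc d : parentOf c d -> ~~ heavy A d.
  move=> cd; apply/negP=> hd; suff /max_c : Q d by rewrite /= leqNgt (parentOf_lt cd).
  by rewrite /Q hd (top_par cd cA) ec eqxx.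
exists c; split.
  have -> : compo A s = compo A c by apply/setP=> z; rewrite inD compoE cA ec.
  exact: centroid_heavy.
have sc : anc s c.
  have [//|cs] := heavy_comparable hs hc (esym ec).
  have [->|ne] := eqVneq c s; first exact: anc_refl.
  have [d cd ds] := anc_child cs ne.
  by have [hd _] := heavy_child cA hs ec cd ds; have := hcc d cd; rewrite hd.
have /prefixP[u eu] := sx; have /prefixP[v ev] := sc.
rewrite eu ev lcp_cat; suff -> : lcp u v = [::] by rewrite cats0.
(* If the paths from [s] to [x] and to [c] began with the same step, the child of [s] they share
   would be heavy and above the edge from below, hence good. *)
case: u eu => [//|a u] eu; case: v ev => [//|b v] ev /=; case: eqP => // eab.
rewrite -{}eab in ev.
have [|d ed] := @addr_ex T (rcons (addr s) a).
  by apply: paths_prefix (addr_in c); rewrite ev -cat_rcons prefix_prefix.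
have sd : parentOf s d by apply/parentOfP; exists a.
have dc : anc d c by rewrite /anc ed ev -cat_rcons prefix_prefix.
have dx : anc d x by rewrite /anc ed eu -cat_rcons prefix_prefix.
have [hd etd] := heavy_child sA hc (esym ec) sd dc.
have := split_child sps sd; rewrite /good hd etd xt.
suff -> : xm A d by [].
by apply/existsP; exists y; rewrite yA (anc_trans dx (parentOf_anc xy)).
Qed.

(** * Removing all splitting nodes at once *)

Definition nxt A := A :\: [set s | splitter A s].

Lemma in_nxt A x : (x \in nxt A) = (x \in A) && ~~ splitter A x.
Proof. by rewrite !inE andbC. Qed.

Lemma nxt_sub A : nxt A \subset A.
Proof. exact: subsetDl. Qed.

Lemma nxt_in A x : x \in nxt A -> x \in A.
Proof. by rewrite in_nxt => /andP[]. Qed.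

(** A piece is either the part above a splitting node, which keeps the old top, or starts at a child
    of the splitting node. *)
Variant nxt_top_spec A z t : Prop :=
| NxtTop s of splitter A s & top A s = t & s != t & top A z = t
| NxtChild s of splitter A s & parentOf s t & top A s = top A z & t \in A.

Lemma nxt_topP A z : z \in nxt A -> nxt_top_spec A z (top (nxt A) z).
Proof.
move=> zA'; have zA := nxt_in zA'; set t := top _ z.
have tA' : t \in nxt A by apply: top_in.
have tA := nxt_in tA'; have et : top A t = top A z by apply/top_mono/nxt_sub.
case: (topP A t) et => [x xt xA|h] et.
  apply: (@NxtChild _ _ _ x) => //.
  by have := top_notin xt; rewrite in_nxt xA negbK.
have [s sps es] := split_ex zA; apply: (@NxtTop _ _ _ s) => //.
  by rewrite es -et.
by apply: contraTneq tA' => <-; rewrite in_nxt sps andbF.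
Qed.

(** Each component has a single splitting node, so inside [compo A s] a round removes [s] and
    nothing else. *)
Lemma compo_nxt A s x : splitter A s -> x \in A -> top A x = top A s -> x != s ->
  compo (compo A s :\ s) x = compo (nxt A) x.
Proof.
move=> sps xA ex ne; have sA := split_in sps.
have inZ z : (z \in compo A s :\ s) = [&& z \in nxt A & top A z == top A s].
  rewrite in_setD1 compoE sA in_nxt /= andbC; case zA: (z \in A) => //=.
  rewrite [RHS]andbC; case: (top A z =P top A s) => //= ez; congr (~~ _).
  by apply/eqP/idP => [->//|spz]; apply: split_uniq ez.
symmetry; apply: compo_sub_closed.
- by apply/subsetP=> z; rewrite inZ => /andP[].
- by rewrite in_setD1 ne compoE sA xA ex eqxx.
move=> u v; rewrite !inZ => /andP[uA' /eqP eu] vA' uv; rewrite vA' -eu eq_sym.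
have uA := nxt_in uA'; have vA := nxt_in vA'.
by apply/eqP/restr_top/and3P; split.
Qed.

(* This potential halves in every round. A component with an edge from below may lose
   almost nothing, but then its large piece has no such edge: this is what the factor 2
   is for. *)
Definition wt A x := #|compo A x| ^ 2 * (xm A (top A x)).+1.

(** Halving the size quarters its square, which pays even for a newly acquired edge from below. *)
Lemma wt_bound (a b : nat) (u v : bool) : 2 * a <= b -> 2 * (a ^ 2 * u.+1) <= b ^ 2 * v.+1.
Proof. by case: u; case: v => h; rewrite -!mulnn; nia. Qed.

Lemma wt_nxt A z : z \in nxt A -> 2 * wt (nxt A) z <= wt A z.
Proof.
move=> zA'; have zA := nxt_in zA'; rewrite /wt !card_compo //.
set t := top (nxt A) z; set m := szm A (top A z).
have tA' : t \in nxt A by apply: top_in.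
have tA := nxt_in tA'; have et : top A t = top A z by apply/top_mono/nxt_sub.
have mono x y : y \in nxt A -> top (nxt A) y = top (nxt A) x -> top A y = top A x.
  by rewrite -(@top_mono _ (nxt A) A y) ?nxt_sub // => _ ->; apply/top_mono/nxt_sub.
have subt : sub (nxt A) t \subset sub A t.
  apply/subsetP=> y; rewrite in_sub => /and4P[yA' _ /eqP ey ty].
  by apply: sub_in (nxt_in yA') tA (mono _ _ yA' ey) ty.
have small_ok : 2 * szm (nxt A) t <= m -> 
    2 * (szm (nxt A) t ^ 2 * (xm (nxt A) t).+1) <= m ^ 2 * (xm A (top A z)).+1.
  exact: wt_bound.
case: (nxt_topP zA') => [s sps es ne ez|s sps st es _]; last rewrite -/t in st.
  (* The piece above [s] misses [sub A s], which is more than half of the component. *)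
  rewrite -/t in es ne ez; apply: small_ok; have sA := split_in sps.
  have : sub (nxt A) t \subset sub A t :\: sub A s.
    apply/subsetP=> y ty; rewrite in_setD (subsetP subt) // andbT.
    apply/negP; rewrite in_sub => /and4P[_ _ _ sy].
    have := ty; rewrite in_sub => /and4P[yA' _ /eqP ey _].
    have := top_between yA' _ sy; rewrite in_nxt sps andbF => h.
    have ett : top (nxt A) t = t by apply: top_top.
    have ts : anc t s by rewrite -es top_anc.
    by have [] // := h _; rewrite (etrans ey ett).
  move/subset_leq_card; rewrite cardsDS; last first.
    by apply: sub_mono => //; rewrite -es ?top_top // top_anc.
  have /andP[_] := split_heavy sps.
  rewrite es /m ez -/(szm (nxt A) t) -/(szm A t) -/(szm A s).
  by move: (szm _ s) (szm A t) (szm _ t) => a b c; lia.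
have := split_child sps st; rewrite /good /heavy tA et /= negb_and -!leqNgt -/m.
have le1 : szm (nxt A) t <= szm A t by apply: subset_leq_card.
case/orP=> [h|]; first by apply: small_ok; lia.
(* The child [t] of [s] may be heavy here, but then the edge from below does not lie under [t]: the
   factor drops from 2 to 1 while the size does not grow. *)
case xtz: (xm A (top A z)) => //; case xt: (xm A t) => // _.
have nsp y : anc t y -> y \in A.
  by move=> ty; apply: contraFT xt => yA; apply/existsP; exists y; rewrite yA.
suff -> : xm (nxt A) t = false.
  have : szm A t <= m.
    apply: subset_leq_card; apply: sub_mono; rewrite ?top_in ?top_top ?et //.
    by rewrite -et top_anc.
  move: le1; rewrite -!mulnn -/m; move: (szm _ t) (szm _ t) (m) => a b c; nia.
(* A node below [t] missing from [nxt A] would be removed in this round. It would belong to the same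
   old component, hence be [s], the parent of [t]. *)
apply/negbTE/negP=> /existsP[y /andP[yA' ty]].
have yA := nsp y ty; have spy : splitter A y by move: yA'; rewrite in_nxt yA negbK.
have ey : top A y = top A t.
  elim/node_ind: y {yA' spy} ty yA => y IH ty yA.
  case: (anc_le ty) => [->//|[p py tp]].
  by rewrite (top_par py (nsp p tp)); apply: IH (parentOf_lt py) tp (nsp p tp).
have e := split_uniq spy sps (etrans ey (etrans et (esym es))).
by have := parentOf_nanc st; rewrite -e ty.
Qed.

Lemma one_below_nxt A : one_below A -> one_below (nxt A).
Proof.
move=> ob x x' y y' xA' xA'' e yA' yA'' xy xy'.
have xA := nxt_in xA'; have x2A := nxt_in xA''.
have eA : top A x = top A x' by rewrite -(top_mono x (nxt_sub A)) e top_mono ?nxt_sub.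
have spl z : z \notin nxt A -> z \in A -> splitter A z by rewrite in_nxt => /nandP[/negP//|/negPn].
(* An old edge from below and one to a fresh splitting node cannot meet in one piece:
   the splitting node is an ancestor of the lower end of the old edge. *)
have mixed u u' v v' : u \in nxt A -> u' \in nxt A -> top (nxt A) u = top (nxt A) u' ->
    top A u = top A u' -> v \in A -> splitter A v -> v' \notin A ->
    parentOf u v -> parentOf u' v' -> False.
  move=> uA' uA'' eu euA vA spv vA' uv uv'.
  have u2A := nxt_in uA''; have ev := top_par uv (nxt_in uA').
  have xt : xm A (top A v).
    apply/existsP; exists v'; rewrite vA' ev euA.
    exact: anc_trans (top_anc A u') (parentOf_anc uv').
  have /existsP[w /andP[wA vw]] : xm A v.
    by have /andP[_] := split_good spv; rewrite xt; case: xm.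
  have [x2 [y2 [x2A' ex2 y2A xy2 vx2]]] := below_edge vA wA vw.
  have [ex _] := ob x2 u' y2 v' x2A' u2A (etrans ex2 (etrans ev euA)) y2A vA' xy2 uv'.
  rewrite {}ex in vx2.
  have [] := top_between uA'' _ vx2; last by rewrite in_nxt spv andbF.
  by rewrite -eu; apply: anc_trans (top_anc _ u) (parentOf_anc uv).
case yA: (y \in A); case yB: (y' \in A).
(* Both lower ends are removed in this round from one component, so they coincide. *)
- have e2 := split_uniq (spl _ yA' yA) (spl _ yA'' yB).
  rewrite (top_par xy xA) (top_par xy' x2A) in e2; have ey := e2 eA.
  by split=> //; apply: parentOf_inj xy _; rewrite ey.
- by case: (mixed x x' y y' xA' xA'' e eA yA (spl _ yA' yA) (negbT yB) xy xy').
- by case: (mixed x' x y' y xA'' xA' (esym e) (esym eA) yB (spl _ yA'' yB) (negbT yA) xy' xy).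
- exact: ob xA x2A eA (negbT yA) (negbT yB) xy xy'.
Qed.

End Round.

(** * Partial decompositions *)

Section Output.
Variable T : btree.
Local Notation node := 'I_(bsize T).
Implicit Types (x y z c s t u : node) (A B : {set node}).

Definition is_top A t := (t \in A) && (top A t == t).

(* Output cell [3 * (s + 1) + b] is meant for the [b]-th child of the removed node [s]
   and cell [0] for the root. *)
Definition cell A a := a = 0 \/ exists s b, [/\ s \notin A, b < 3 & a = 3 * s.+1 + b].

Lemma cell_inj s s' b b' : b < 3 -> b' < 3 -> 3 * s.+1 + b = 3 * s'.+1 + b' ->
  s = s' /\ b = b'.
Proof.
move=> h h' e; have e1 : s = s' :> nat by lia.
by split; [exact: val_inj | lia].
Qed.

(* [slot t] is the cell awaiting the splitting node of the component with top [t]. The last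
   field says that any way of completing the pending cells completes the whole output. *)
Record outinv A (slot : node -> nat) (out : nat -> nat) : Prop := OutInv {
  oi_cell : forall t, is_top A t -> cell A (slot t);
  oi_zero : forall x b, x \in A -> b < 3 -> out (3 * x.+1 + b) = 0;
  oi_inj : forall t u, is_top A t -> is_top A u -> slot t = slot u -> t = u;
  oi_mcd : forall m : memory,
    (forall a, cell A a -> (forall t, is_top A t -> slot t <> a) -> m a = out a) ->
    (forall t, is_top A t ->
       exists tr, decodes m 3 (m (slot t)) tr /\ is_mcd (compo A t) tr) ->
    exists tr, decodes m 3 (m 0) tr /\ is_mcd [set: node] tr }.

Lemma is_top_top A x : x \in A -> is_top A (top A x).
Proof. by move=> xA; rewrite /is_top top_in ?top_top ?eqxx. Qed.

Lemma addr_nil x : (forall p, ~~ parentOf p x) -> addr x = [::].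
Proof.
move=> h; case/lastP E: (addr x) => [//|q b].
have [|p ep] := @addr_ex T q; first by apply: paths_prefix (addr_in x); rewrite E prefix_rcons.
by have /negP[] := h p; apply/parentOfP; exists b; rewrite E ep.
Qed.

(** There is one component, pending at cell 0; a constant slot is injective on its single top. *)
Lemma outinv0 : outinv [set: node] (fun=> 0) (fun=> 0).
Proof.
have nil t : addr (top [set: node] t) = [::].
  by apply: addr_nil => p; apply/negP=> /top_notin; rewrite inE.
split=> //; first by left.
  move=> t u /andP[_ /eqP et] /andP[_ /eqP eu] _.
  by apply: addr_inj; rewrite -et -eu !nil.
have [r er] := addr_ex (nil_paths T).
move=> m _ H; have [|tr [h1 h2]] := H r.
  by rewrite /is_top inE; apply/eqP/addr_inj; rewrite nil er.
exists tr; split=> //; suff <- : compo [set: node] r = [set: node] by [].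
by apply/setP=> y; rewrite compoE !inE /=; apply/eqP/addr_inj; rewrite !nil.
Qed.

(** * Effect of one round on the output *)

Section Step.
Variables (A : {set node}) (slot slot' : node -> nat) (out out' : nat -> nat).
Hypotheses (ob : one_below A) (inv : outinv A slot out).
Hypothesis out_split : forall s, splitter A s -> out' (slot (top A s)) = s.+1.
Hypothesis out_other : forall a, (forall s, splitter A s -> a <> slot (top A s)) ->
  out' a = out a.
Hypothesis slot_child : forall s (b : bool) c, splitter A s -> childOf b s = Some c ->
  c \in A -> slot' c = 3 * s.+1 + b.
Hypothesis slot_top : forall s, splitter A s -> top A s != s ->
  slot' (top A s) = 3 * s.+1 + 2.

Lemma pending t : is_top (nxt A) t -> exists s b, [/\ splitter A s, slot' t = 3 * s.+1 + b &
  (exists2 b' : bool, b = b' & childOf b' s = Some t) \/ [/\ b = 2, top A s = t & s != t]].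
Proof.
case/andP=> tA' /eqP et; case: (nxt_topP tA'); rewrite et.
  move=> s sps es ne _; exists s, 2; split=> //; last by right.
  by rewrite -es slot_top // es eq_sym.
move=> s sps st _ tA; have [b eb] := parent_childOf st.
by exists s, (b : nat); split=> //; [rewrite (slot_child sps eb) | left; exists b].
Qed.

(** New pending cells belong to nodes removed in this round, cells of [A] to the root or to nodes
    removed before; hence later writes leave the finished output alone. *)
Lemma pending_cell t a : is_top (nxt A) t -> cell A a -> slot' t <> a.
Proof.
case/pending=> s [b [sps -> hb]] [->|[s' [b' [s'A hb' ->]]]] e; first by lia.
have hb3 : b < 3 by case: hb => [[[] -> _]|[->]].
have [ess _] := cell_inj hb3 hb' e.
by move: s'A; rewrite -ess (split_in sps).
Qed.

Lemma cell_nxt a : cell A a -> cell (nxt A) a.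
Proof.
case=> [->|[s [b [sA hb ->]]]]; [by left | right; exists s, b; split=> //].
by apply: contra sA; apply: nxt_in.
Qed.

Lemma split_nxt s : splitter A s -> s \notin nxt A.
Proof. by move=> sps; rewrite in_nxt sps andbF. Qed.

Lemma cell_split s b : splitter A s -> b < 3 -> cell (nxt A) (3 * s.+1 + b).
Proof. by move=> sps hb; right; exists s, b; rewrite split_nxt. Qed.

Lemma out'0 x b : x \in A -> b < 3 -> out' (3 * x.+1 + b) = 0.
Proof.
move=> xA hb; rewrite out_other; first exact: (oi_zero inv).
move=> s sps e; case: (oi_cell inv (is_top_top (split_in sps))).
  by move=> e0; rewrite e0 in e; lia.
case=> s' [b' [s'A hb' e']]; rewrite e' in e.
by have [exs _] := cell_inj hb hb' e; rewrite -exs xA in s'A.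
Qed.

Lemma outinv_step : outinv (nxt A) slot' out'.
Proof.
split.
- move=> t /pending[s [b [sps -> hb]]]; apply: cell_split => //.
  by case: hb => [[[] -> _]|[->]].
- by move=> x b /nxt_in; apply: out'0.
- move=> t u /pending[s [b [sps -> hb]]] /pending[s' [b' [sps' -> hb']]] e.
  have hb3 : b < 3 by case: hb => [[[] -> _]|[->]].
  have hb3' : b' < 3 by case: hb' => [[[] -> _]|[->]].
  have [ess eb] := cell_inj hb3 hb3' e; subst s' b'.
  case: hb hb' => [[c -> ec]|[-> <- _]] [[c' e' ec']|[e' <- _]] //.
  - have ecc : c = c' by case: c c' e' {ec ec'} => [] [].
    by move: ec'; rewrite -ecc ec => -[].
  - by case: c e' {ec}.
  - by case: c' e' {ec'}.
(* A completion of the new pending cells also completes the old ones: [slot t] already holds the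
   code of the splitting node of [t], and each child cell of that node is pending or holds 0 for an
   empty piece. *)
move=> m Hm Ht; apply: (oi_mcd inv) => [a ca nta|t tt].
  rewrite Hm; [|exact: cell_nxt | by move=> t /pending_cell; apply].
  by rewrite out_other // => s sps e; apply: (nta (top A s)); rewrite ?is_top_top ?split_in.
have /andP[tA /eqP et] := tt.
have [s sps es] := split_ex tA; rewrite et in es; have sA := split_in sps.
have -> : m (slot t) = s.+1.
  rewrite Hm -?es ?out_split //; first exact/cell_nxt/(oi_cell inv)/is_top_top.
  by move=> u /pending_cell; apply; apply/(oi_cell inv)/is_top_top.
have m0 b : b < 3 -> (forall u, is_top (nxt A) u -> slot' u <> 3 * s.+1 + b) ->
    m (3 * s.+1 + b) = 0.
  by move=> hb h; rewrite Hm // ?out'0 //; apply: cell_split.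
have children (b : bool) : exists tr, decodes m 3 (m (3 * s.+1 + b)) tr /\
    is_mcd (piece (compo A s) s (childOf b s)) tr.
  have b3 : b < 3 by case: b.
  (* A child outside [A] gives an empty piece, like an absent child. *)
  have [[c [cA ec]]|h] : (exists c, c \in A /\ childOf b s = Some c) \/
      (forall c, childOf b s = Some c -> c \notin A).
  - case E: (childOf b s) => [c|]; last by right.
    by case cA: (c \in A); [left; exists c | right=> c' [<-]; rewrite cA].
  - have sc := childOf_parent ec; have tc := top_par sc sA.
    have ne : c != s by rewrite eq_sym (parentOf_neq sc).
    have cA' : c \in nxt A.
      rewrite in_nxt cA; apply: contra ne => spc; apply/eqP.
      exact: split_uniq spc sps tc.
    have [|tr [h1 h2]] := Ht c.
      rewrite /is_top cA'; apply/eqP/top_self => p pc.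
      by rewrite -(parentOf_inj sc pc) split_nxt.
    exists tr; rewrite ec /= -(slot_child sps ec cA); split=> //.
    by rewrite compo_nxt.
  exists MEmpty; split.
    apply: m0 => // u tu; have := pending tu => -[s' [b' [_ -> hb]]] e.
    have hb3 : b' < 3 by case: hb => [[[] -> _]|[->]].
    have [es' eb'] := cell_inj hb3 b3 e; subst s' b'.
    case: hb => [[c ebc ec]|[eb2 _ _]]; last by case: b eb2 {b3 h e hb3}.
    have ebb : b = c by case: b c ebc {ec b3 h e hb3} => [] [].
    have := h u; rewrite ebb => /(_ ec) /negP; apply.
    by case/andP: tu => /nxt_in.
  rewrite /piece /=; case E: childOf => [c|] //; apply/setP=> z.
  by rewrite compoE in_setD1 compoE (negbTE (h c E)) !andbF /= in_set0.
have parent : exists tr, decodes m 3 (m (3 * s.+1 + 2)) tr /\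
    is_mcd (piece (compo A s) s (parentNode s)) tr.
  have [e|ne] := eqVneq (top A s) s.
    exists MEmpty; split.
      apply: m0 => // u tu; have := pending tu => -[s' [b' [_ -> hb]]] eb.
      have hb3 : b' < 3 by case: hb => [[[] -> _]|[->]].
      have [es' eb'] := cell_inj hb3 (isT : 2 < 3) eb; subst s' b'.
      by case: hb => [[[]]|[_ eu]] //; rewrite -eu e eqxx.
    rewrite /piece /=; case E: parentNode => [p|] //; apply/setP=> z.
    move/parentNodeP: E => ps; rewrite -e in ps.
    by rewrite compoE in_setD1 compoE (negbTE (top_notin ps)) !andbF /= in_set0.
  (* The piece containing the parent of [s] keeps the top [t], so it is pending under [t]. *)
  have tt' : is_top (nxt A) t.
    rewrite /is_top in_nxt tA; apply/andP; split.
      by apply: contra ne => spt; rewrite es; apply/eqP/(split_uniq spt sps); rewrite et es.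
    apply/eqP/top_self => p pt; apply: contra (top_notin (A := A) (y := t) (x := p) _).
      exact: nxt_in.
    by rewrite et.
  have [tr [h1 h2]] := Ht t tt'.
  exists tr; rewrite -slot_top // es; split=> //.
  case: (topP A s) ne es => [p ps pA|_]; last by rewrite eqxx.
  move=> ne es; rewrite (parentNodeP _ _ ps) /=.
  have tp := top_par ps pA.
  rewrite compo_nxt //; last exact: parentOf_neq.
  have nsp z : anc z p -> z \in A -> top A z = top A p -> z \in nxt A.
    move=> zp zA ez; rewrite in_nxt zA; apply/negP=> spz.
    have ezs := split_uniq spz sps (etrans ez (esym tp)).
    by have := parentOf_nanc ps; rewrite -ezs zp.
  have pA' : p \in nxt A by apply: nsp (anc_refl p) pA erefl.
  suff -> : compo (nxt A) p = compo (nxt A) t by [].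
  have /andP[tA' /eqP et'] := tt'.
  suff ept : top (nxt A) p = t by apply/setP=> z; rewrite !compoE pA' tA' ept et'.
  have tpa : anc t p by rewrite -es top_anc.
  apply: top_eq tpa _ => [q qt|z tz zp _].
    by rewrite -et' in qt; apply: top_notin qt.
  have [|zA ez] := top_between pA _ zp; first by rewrite es.
  exact: nsp.
have [ta [a1 a2]] := children false; have [tb [b1 b2]] := children true.
have [tc [c1 c2]] := parent; exists (MNode s ta tb tc); split.
  (* With base 3, the cells that [decodes] reads for node [s] are those numbered by its code [s.+1];
     cell 0 stays free for the root. *)
  rewrite /= (_ : 3 + 3 * s = 3 * s.+1 + 0); last by lia.
  rewrite (_ : (3 * s.+1 + 0).+1 = 3 * s.+1 + 1); last by lia.
  by rewrite (_ : (3 * s.+1 + 1).+1 = 3 * s.+1 + 2); last by lia.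
have -> : compo A t = compo A s by apply/setP=> z; rewrite !compoE tA sA et es.
exists s; split=> //; split; first by rewrite compoE sA eqxx.
split; first exact: split_okP.
by do 3!eexists; split; [exact: perm_refl | split].
Qed.

End Step.

(** [is_mcd] guarantees that the stored numbers are nodes of the tree, so decoding reads only the
    first [3 * bsize T] cells after the base. *)
Lemma decodes_transfer (m m' : memory) (b b' : nat) (t : mtree) C code :
  (forall a, a < 3 * bsize T -> m' (b' + a) = m (b + a)) ->
  is_mcd (T := T) C t -> decodes m b code t -> decodes m' b' code t.
Proof.
move=> h; elim: t C code => [//|j t1 IH1 t2 IH2 t3 IH3] C code /=.
case=> s [es [_ [_ [D1 [D2 [D3 [_ [ha [hb hc]]]]]]]]] [-> [da [db dc]]].
have lt := ltn_ord s; rewrite es in lt.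
rewrite -!addnS !h; try lia; rewrite !addnS; split=> //.
by split; [exact: IH1 ha da | split; [exact: IH2 hb db | exact: IH3 hc dc]].
Qed.

End Output.

(** * The program *)

Notation rV := 1 (only parsing).
Notation rL := 2 (only parsing).
Notation rR := 3 (only parsing).
Notation rN := 4 (only parsing).
Notation rP := 5 (only parsing).
Notation rO := 6 (only parsing).

Notation aRem := 1 (only parsing).
Notation aSize := 2 (only parsing).
Notation aEdge := 3 (only parsing).
Notation aTop := 4 (only parsing).
Notation aGood := 5 (only parsing).
Notation aSlot := 6 (only parsing).
Notation aOut := 7 (only parsing).

Declare Scope expr_scope.
Delimit Scope expr_scope with E.
Notation "a + b" := (EO Add a b) : expr_scope.
Notation "a - b" := (EO Sub a b) : expr_scope.
Notation "a * b" := (EO Mul a b) : expr_scope.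
Notation "a < b" := (EO Lt a b) : expr_scope.
Bind Scope expr_scope with expr.
Notation V := (ER rV).
Notation L := (ER rL).
Notation R := (ER rR).
Notation c0 := (EC 0).
Notation c1 := (EC 1).

(* Codes are node numbers plus one; every array has a dummy entry 0 for absent children. *)
Definition kids := CSeq (CSet rR (EI V)) (CSet rL ((c0 < R) * (V + c1))%E).

Definition pass1_body := CSeq (CSto aSize V ((c1 - EA aRem V) * (c1 + (EA aSize L + EA aSize R)))%E)
  (CSeq (CSto aEdge V (c0 < EA aRem V + EA aEdge L + EA aEdge R)%E) (CSet rV (V - c1)%E)).
Definition pass1 := CSeq (CSet rV (ER rN)) (CWhile V (CSeq kids pass1_body)).

(** Products with 0/1 flags replace branching. The children of a removed node become their own tops;
    at a leaf both writes go to the dummy entry of [aTop]. *)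
Definition pass2_body :=
  CSeq (CSto aGood V ((c1 - EA aRem V) * (EA aSize (EA aTop V) < EA aSize V + EA aSize V) *
                       (EA aEdge (EA aTop V) < EA aEdge V + c1))%E)
  (CSeq (CSto aTop L (EA aRem V * L + (c1 - EA aRem V) * EA aTop V)%E)
  (CSeq (CSto aTop R (EA aRem V * R + (c1 - EA aRem V) * EA aTop V)%E)
        (CSet rV (V + c1)%E))).
Definition pass2 := CSeq (CSto aTop c1 c1) (CSeq (CSet rV c1)
  (CWhile (V < ER rN + c1)%E (CSeq kids pass2_body))).

(** The old slot is used before it is replaced by that of the piece above. If [V] is its own top,
    the replacement concerns a removed node and is harmless. *)
Definition emit :=
  CSeq (CSto aOut (EA aSlot (EA aTop V)) V)
  (CSeq (CSto aSlot (EA aTop V) (EC 3 * V + EC 2)%E)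
  (CSeq (CSto aSlot L (EC 3 * V)%E)
  (CSeq (CSto aSlot R (EC 3 * V + c1)%E) (CSto aRem V c1)))).
(** The test reads only [aGood], which is complete before this scan, so removing nodes during the
    scan does not affect it. *)
Definition pass3_body :=
  CSeq (CWhen (EA aGood V * ((c1 - EA aGood L) * (c1 - EA aGood R)))%E emit)
       (CSet rV (V + c1)%E).
Definition pass3 := CSeq (CSet rV c1) (CWhile (V < ER rN + c1)%E (CSeq kids pass3_body)).

Definition round := CSeq pass1 (CSeq pass2 (CSeq pass3 (CSet rP (ER rP + ER rP)%E))).

(** Throughout, weight times [rP] is at most the square of the number of nodes; once [rP] exceeds
    that square, no node is left. *)
Definition main := CSeq (CSet rN (EI c0)) (CSeq (CSet rP c1)
  (CSeq (CWhile (ER rP < ER rN * ER rN + c1)%E round) (CSet rO (EA aOut c0)))).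

Section Passes.
Variable T : btree.
Local Notation node := 'I_(bsize T).
Local Notation N := (bsize T).
Implicit Types (x y z c t p : node) (X : {set node}) (s : st).

(** Must accommodate the counter [rP], which may reach [2 * N ^ 2], and output cell numbers up to
    [3 * N + 2]. *)
Definition K := 4 * (N + 2) ^ 2.
Definition I v := input T v.*2.

Definition kid (b : bool) x : nat := if childOf b x is Some c then c.+1 else 0.

Lemma kidP b x : child_code T (addr x) b = kid b x.
Proof.
rewrite /child_code /kid; case E: childOf => [c|].
  by have /childOfP/eqP <- := E; rewrite addr_in index_addr.
case: ifP => // /addr_ex[c /eqP/childOfP]; by rewrite E.
Qed.

Lemma kid_le b x : kid b x <= N.
Proof. by rewrite /kid; case: childOf => [c|]. Qed.

Lemma I_node x : I x.+1 = kid true x.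
Proof. by rewrite /I /input doubleS /= uphalf_double ltn_ord odd_double /= kidP. Qed.

Lemma I0 : I 0 = N. Proof. by []. Qed.

Lemma child_code_le q b : child_code T q b <= N.
Proof. by rewrite /child_code; case: ifP => //; rewrite -size_paths index_mem. Qed.

Lemma input_le a : input T a <= N.
Proof. by rewrite /input; case: ifP => // _; case: ifP => // _; apply: child_code_le. Qed.

Lemma N_K : 3 * N + 5 <= K.
Proof. by rewrite /K -mulnn; nia. Qed.

Lemma I_le v : I v <= K.
Proof. by apply: leq_trans (input_le _) _; have := N_K; lia. Qed.

(* In preorder the left child of node [x] is node [x + 1], so the codes of the left children
   are redundant and their (odd) memory cells can be used as registers. *)
Lemma kid_false x : (0 < kid true x) * x.+2 = kid false x.
Proof.
rewrite -!kidP /child_code; case: ifP => [/paths_sibling hl|hr].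
  by rewrite hl mul1n index_left_child // index_addr.
case: ifP => // /paths_sibling; by rewrite hr.
Qed.

Lemma kid_eq b x y : (y.+1 == kid b x) = (childOf b x == Some y).
Proof.
rewrite /kid; case: childOf => [c|//].
by rewrite eqSS; apply/eqP/eqP => [/val_inj->//|[->]].
Qed.

Lemma kid_neq b x : (x.+1 == kid b x) = false.
Proof.
rewrite kid_eq; apply/eqP => /childOf_parent/parentOf_lt; by rewrite ltnn.
Qed.

Lemma arr_kid s f b x (g : node -> nat) : arr s f 0 = 0 ->
  (forall c, parentOf x c -> arr s f c.+1 = g c) ->
  arr s f (kid b x) = omap0 g (childOf b x).
Proof.
by move=> h0 h; rewrite /kid; case E: childOf => [c|//]; apply/h/(childOf_parent E).
Qed.

Lemma kids_ok s x : reg s rV = x.+1 ->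
  [/\ safe K I kids s, arr (exec I kids s) = arr s,
      reg (exec I kids s) rL = kid false x, reg (exec I kids s) rR = kid true x
    & forall r, r \notin [:: rL; rR] -> reg (exec I kids s) r = reg s r].
Proof.
move=> ev; have leK n : n <= N -> n <= K by have := N_K; lia.
rewrite /= ev I_node addn1 kid_false; split=> //; first by split; apply/leK/kid_le.
by move=> r; rewrite !inE => /norP[/negbTE-> /negbTE->].
Qed.

(** * Invariants of the three scans *)

Definition same (fs : seq nat) s s' := [/\ reg s' rN = reg s rN, reg s' rP = reg s rP
  & forall f v, f \notin fs -> arr s' f v = arr s f v].

Definition removed X s := arr s aRem 0 = 0 /\ forall x, arr s aRem x.+1 = (x \notin X).
Definition sized X s := [/\ arr s aSize 0 = 0, arr s aEdge 0 = 0 &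
  forall x, arr s aSize x.+1 = szm X x /\ arr s aEdge x.+1 = xm X x].

Definition inv1 X s0 i s := [/\ reg s rV = i, i <= N, same [:: aSize; aEdge] s0 s,
  arr s aSize 0 = 0 /\ arr s aEdge 0 = 0 &
  forall x, i <= x -> arr s aSize x.+1 = szm X x /\ arr s aEdge x.+1 = xm X x].

Lemma pass1_step X s0 i s : removed X s0 -> inv1 X s0 i s -> reg s rV != 0 ->
  [/\ 0 < i, safe K I (CSeq kids pass1_body) s &
      inv1 X s0 i.-1 (exec I (CSeq kids pass1_body) s)].
Proof.
move=> [r0 rx] [ei le [sN sP sA] [z0 e0] h]; rewrite ei -lt0n => i0.
case: i i0 ei le h => // i _ ei le h.
pose x : node := Ordinal le; have [k1 k2 k3 k4 k5] := @kids_ok s x ei.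
suff [] : safe K I pass1_body (exec I kids s) /\
    inv1 X s0 i (exec I pass1_body (exec I kids s)) by [].
move: (exec I kids s) k2 k3 k4 k5 => s1 k2 k3 k4 k5.
have v1 : reg s1 rV = x.+1 by rewrite k5.
have hc b f g : arr s f 0 = 0 -> (forall y, i < y -> arr s f y.+1 = g y) ->
    arr s f (kid b x) = omap0 g (childOf b x).
  by move=> hf hy; apply: arr_kid => // c /parentOf_lt; apply: hy.
have rem1 v : arr s aRem v = arr s0 aRem v by rewrite sA.
have E1 : (1 - (x \notin X)) * (1 + (arr s aSize (kid false x) + arr s aSize (kid true x)))
    = szm X x.
  case xX: (x \in X); last by rewrite szm_notin ?xX.
  rewrite mul1n add1n (szm_rec xX); congr (_ + _).+1;
  by apply: hc => // y /h[].
have E2 : (0 < (x \notin X) + arr s aEdge (kid false x) + arr s aEdge (kid true x)) = xm X x.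
  rewrite xm_rec; congr (0 < _ + _ + _); by apply: hc => // y /h[].
rewrite /= /inv1 /= !v1 !k2 !k3 !k4 !rem1 !rx !E1 !E2 subn1 /=; split.
  have := szm_le X x; have := N_K; split; first lia.
  by split; [apply: leq_trans (leq_b1 _) _; rewrite /K; lia | lia].
split=> //=.
- exact: ltnW.
- split=> /=; rewrite ?k5 // => f v; rewrite !inE => /norP[/negbTE n1 /negbTE n2].
  by rewrite n1 n2 /= k2 sA // !inE n1 n2.
- move=> y le_y; case: eqP => [[e]|ne].
    by have -> : y = x by apply: val_inj.
  by rewrite /= ?k2; apply: h; lia.
Qed.

Lemma pass1_ok X s : reg s rN = N -> removed X s -> arr s aSize 0 = 0 -> arr s aEdge 0 = 0 ->
  exists n s', [/\ n <= N.+2 * (20 + csz pass1), bs K I pass1 s n s',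
    same [:: aSize; aEdge] s s' & sized X s'].
Proof.
move=> eN rx z0 e0; set s1 := set_reg s rV N.
have b1 : bs K I (CSet rV (ER rN)) s (csz (CSet rV (ER rN))) s1.
  by rewrite /s1 -eN; apply: bs_set; rewrite /= eN; have := N_K; lia.
have J1 : inv1 X s N s1.
  by split=> //= x; rewrite leqNgt ltn_ord.
have [i t ht ne|n [s' [j [hn hb [ej le sm [z e] h] ev0]]]] :=
   @bs_while K I (inv1 X s) V (CSeq kids pass1_body) (csz (CSeq kids pass1_body)) _ N s1 J1.
  have [i0 sf ht'] := pass1_step rx ht ne.
  by have [m hm hb] := bs_exec sf; exists m; eexists; split; eauto.
exists (csz (CSet rV (ER rN)) + n), s'; split=> //.
- have -> : csz pass1 = csz (CSet rV (ER rN)) + (size (cE V nreg) + 1 + csz (CSeq kids pass1_body) + 1) by [].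
  by move: hn; move: (csz _) (csz _) (size _) => a b c; nia.
- exact: bs_seq b1 hb.
- by split=> // x; apply: h; rewrite -ej -[reg s' _]/(ev I V s') ev0.
Qed.

(* [v] is the next code to be processed. *)
Definition inv2 X s0 i s := exists v, [/\ 0 < v, v + i = N.+1 /\ reg s rV = v,
  same [:: aTop; aGood] s0 s,
  forall y, (forall p, parentOf p y -> p.+1 < v) -> arr s aTop y.+1 = (top X y).+1 &
  arr s aGood 0 = 0 /\ forall x, x.+1 < v -> arr s aGood x.+1 = good X x].

Lemma pass2_step X s0 i s : removed X s0 -> sized X s0 -> inv2 X s0 i s -> 
  reg s rN = N -> reg s rV < N.+1 ->
  [/\ 0 < i, safe K I (CSeq kids pass2_body) s &
      inv2 X s0 i.-1 (exec I (CSeq kids pass2_body) s)].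
Proof.
move=> [r0 rx] [z0 e0 sz] [v [v0 [vi ev] [sN sP sA] tp [g0 gd]]] eN; rewrite ev => ltv.
case: v v0 vi ev tp gd ltv => // v _ vi ev tp gd; rewrite ltnS => ltv.
pose x : node := Ordinal ltv; have [k1 k2 k3 k4 k5] := @kids_ok s x ev.
suff [] : safe K I pass2_body (exec I kids s) /\
    inv2 X s0 i.-1 (exec I pass2_body (exec I kids s)) by split=> //; lia.
move: (exec I kids s) k2 k3 k4 k5 => s1 k2 k3 k4 k5.
have v1 : reg s1 rV = x.+1 by rewrite k5.
have fr f u : f \notin [:: aTop; aGood] -> arr s1 f u = arr s0 f u by move=> h; rewrite k2 sA.
have sA' f y : f \notin [:: aTop; aGood] -> arr s1 f y.+1 = arr s0 f y.+1 by apply: fr.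
have tx : arr s1 aTop x.+1 = (top X x).+1.
  by rewrite k2; apply: tp => p /parentOf_lt.
have E1 : (1 - (x \notin X)) * (szm X (top X x) < szm X x + szm X x) *
     (xm X (top X x) < xm X x + 1) = good X x.
  rewrite /good /heavy addn1 ltnS addnn -mul2n.
  by case: (x \in X); case: (_ < _); case: (_ <= _).
have vk : (v.+1 == kid false x) = false by apply: (kid_neq false x).
pose tv b := (x \notin X) * kid b x + (1 - (x \notin X)) * (top X x).+1.
have tv_le b : tv b <= N.
  rewrite /tv; have := kid_le b x; have := ltn_ord (top X x).
  by case: (x \notin X); rewrite ?mul1n ?mul0n ?addn0.
have tvE b c : childOf b x = Some c -> tv b = (top X c).+1.
  move=> ec; have xc := childOf_parent ec; rewrite /tv /kid ec.
  case xX: (x \in X); first by rewrite (top_par xc xX) mul1n.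
  by rewrite (@top_self _ _ c) ?mul1n ?addn0 // => p pc; rewrite (parentOf_inj pc xc) xX.
rewrite /= /inv2 /= !v1 !tx !k3 !k4 !sA' // !rx !(proj1 (sz _)) !(proj2 (sz _)) !E1 /=.
rewrite vk -!/(tv _); split.
  have := N_K; have := tv_le false; have := tv_le true; case: (good X x) => /= h1 h2 h3;
  by do !split; lia.
exists v.+2; rewrite addn1; split=> //; first by split=> //; lia.
- split=> /=; rewrite ?k5 // => f u; rewrite !inE => /norP[n1 n2].
  by rewrite (negbTE n1) (negbTE n2) /= fr // !inE negb_or n1 n2.
- move=> y hy /=; rewrite !kid_eq.
  case: eqP => [/tvE //|n1]; case: eqP => [/tvE //|n0].
  rewrite k2; apply: tp => p py; have := hy p py; rewrite ltnS leq_eqVlt => /orP[/eqP[e]|//].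
  have [b eb] := parent_childOf py; have ex : p = x by apply: val_inj.
  by case: b eb; rewrite ex.
- split=> [|y] /=; first by rewrite k2.
  rewrite ltnS leq_eqVlt => /orP[/eqP[e]|h]; last by rewrite k2 gd //; case: eqP h => // ->; rewrite ltnn.
  by rewrite e eqxx; congr (nat_of_bool (good X _)); apply: val_inj.
Qed.

Lemma pass2_ok X s : reg s rN = N -> removed X s -> sized X s -> arr s aGood 0 = 0 ->
  exists n s', [/\ n <= N.+2 * (20 + csz pass2), bs K I pass2 s n s',
    same [:: aTop; aGood] s s', arr s' aGood 0 = 0 &
    forall x, arr s' aGood x.+1 = good X x /\ arr s' aTop x.+1 = (top X x).+1].
Proof.
move=> eN rx sz g0; set s1 := set_arr s aTop 1 1; set s2 := set_reg s1 rV 1.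
have h1K : 1 <= K by have := N_K; lia.
have b1 : bs K I (CSto aTop c1 c1) s (csz (CSto aTop c1 c1)) s1 by apply: bs_sto.
have b2 : bs K I (CSet rV c1) s1 (csz (CSet rV c1)) s2 by apply: bs_set.
have J2 : inv2 X s N s2 /\ reg s2 rN = N.
  split=> //; exists 1; split=> //.
    by split=> // f v; rewrite !inE => /norP[/negbTE n1 _]; rewrite /= n1.
  (* Before any node is processed, the claim on [aTop] concerns the root only. *)
  move=> y hy; have ny p : ~~ parentOf p y by apply/negP=> /hy.
  have y0 : y = 0 :> nat by rewrite -index_addr (addr_nil ny) index_nil_paths.
  by rewrite top_self => [|p]; [rewrite /= y0 | rewrite (negbTE (ny p))].
pose J i (t : st) := inv2 X s i t /\ reg t rN = N.
have [i t [ht tN] ne|n [s' [j [hn hb [[v [v0 [vj ev] sm tp [g0' gd]]] sN] ev0]]]] :=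
   @bs_while K I J (V < ER rN + c1)%E (CSeq kids pass2_body)
     (csz (CSeq kids pass2_body)) _ N s2 J2.
  have lt : reg t rV < N.+1 by move: ne; rewrite /= tN addn1; case: (_ < _).
  have [i0 sf ht'] := pass2_step rx sz ht tN lt.
  have [m hm hb] := bs_exec sf; exists m; eexists; split=> //; first exact: hb.
  by split=> //; have [v [_ _ [-> _ _] _ _]] := ht'.
have vN : N < v by move: ev0; rewrite /= ev sN addn1 ltnNge; case: leqP.
exists (csz (CSto aTop c1 c1) + (csz (CSet rV c1) + n)), s'; split=> //.
- have -> : csz pass2 = csz (CSto aTop c1 c1) + (csz (CSet rV c1) +
     (size (cE (V < ER rN + c1)%E nreg) + 1 + csz (CSeq kids pass2_body) + 1)) by [].
  by move: hn; move: (csz _) (csz _) (csz _) (size _) => a b c d; nia.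
- exact: bs_seq b1 (bs_seq b2 hb).
- move=> x; split; first by apply: gd; apply: leq_ltn_trans vN.
  by apply: tp => p px; apply: leq_ltn_trans vN.
Qed.

Lemma splitter_kids X x : good X x * ((1 - omap0 (fun c => good X c) (childOf false x)) *
   (1 - omap0 (fun c => good X c) (childOf true x))) = splitter X x.
Proof.
rewrite /splitter; case: (good X x) => //=; rewrite mul1n.
have -> : [forall c, parentOf x c ==> ~~ good X c] =
    (omap0 (fun c => good X c) (childOf false x) == 0) &&
    (omap0 (fun c => good X c) (childOf true x) == 0).
  apply/forallP/andP => [h|[h0 h1] c].
    by split; case E: childOf => [c|] //=; have := h c; rewrite (childOf_parent E) /=; case: good.
  apply/implyP=> /parent_childOf[b eb].
  by case: b eb => eb; move: h0 h1; rewrite eb /=; case: good.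
by case: (childOf false x) => [c|]; case: (childOf true x) => [d|] //=; do ?case: good.
Qed.

(** Output addresses refer to the slots in the initial state [s0], because the slot of a component
    changes when its splitting node is met. The last clause keeps the slots of the components not
    yet met. *)
Definition inv3 X s0 i s := exists v, [/\ 0 < v, v + i = N.+1 /\ reg s rV = v,
  same [:: aRem; aSlot; aOut] s0 s,
  arr s aRem 0 = 0 /\ forall x, arr s aRem x.+1 = (x \notin X) || splitter X x && (x.+1 < v) &
  [/\ forall x, splitter X x -> x.+1 < v -> arr s aOut (arr s0 aSlot (top X x).+1) = x.+1,
      forall a, (forall x, splitter X x -> x.+1 < v -> a <> arr s0 aSlot (top X x).+1) ->
        arr s aOut a = arr s0 aOut a,
      forall x (b : bool) c, splitter X x -> x.+1 < v -> childOf b x = Some c -> c \in X ->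
        arr s aSlot c.+1 = 3 * x.+1 + b,
      forall x, splitter X x -> x.+1 < v -> top X x != x ->
        arr s aSlot (top X x).+1 = 3 * x.+1 + 2 &
      forall x, splitter X x -> v <= x.+1 ->
        arr s aSlot (top X x).+1 = arr s0 aSlot (top X x).+1]].

Definition slots s x := arr s aSlot x.+1.

Lemma pass3_step X s0 i s : removed X s0 -> outinv X (slots s0) (arr s0 aOut) ->
  arr s0 aGood 0 = 0 ->
  (forall x, arr s0 aGood x.+1 = good X x /\ arr s0 aTop x.+1 = (top X x).+1) ->
  inv3 X s0 i s -> reg s rN = N -> reg s rV < N.+1 ->
  [/\ 0 < i, safe K I (CSeq kids pass3_body) s &
      inv3 X s0 i.-1 (exec I (CSeq kids pass3_body) s)].
Proof.
move=> [r0 rx] oi g0 gt [v [v0 [vi er] [sN sP sA] [q0 qx] [o1 o2 l1 l2 l3]]] eN; rewrite er => ltv.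
case: v v0 vi er qx o1 o2 l1 l2 l3 ltv => // v _ vi er qx o1 o2 l1 l2 l3; rewrite ltnS => ltv.
pose x : node := Ordinal ltv; have [k1 k2 k3 k4 k5] := @kids_ok s x er.
suff [] : safe K I pass3_body (exec I kids s) /\
    inv3 X s0 i.-1 (exec I pass3_body (exec I kids s)) by split=> //; lia.
move: (exec I kids s) k2 k3 k4 k5 => s1 k2 k3 k4 k5.
have v1 : reg s1 rV = x.+1 by rewrite k5.
have fr f u : f \notin [:: aRem; aSlot; aOut] -> arr s1 f u = arr s0 f u by move=> h; rewrite k2 sA.
have gk b : arr s1 aGood (kid b x) = omap0 (fun c => good X c) (childOf b x).
  by apply: arr_kid => [|c _]; rewrite fr // (proj1 (gt _)).
have tx : arr s1 aTop x.+1 = (top X x).+1 by rewrite fr // (proj2 (gt _)).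
have cond : ev I (EA aGood V * ((c1 - EA aGood L) * (c1 - EA aGood R)))%E s1 = splitter X x.
  by rewrite /= v1 k3 k4 !gk fr // (proj1 (gt _)) splitter_kids.
have ltS y : (y.+1 < v.+2) = (y == x) || (y.+1 < v.+1).
  by rewrite ltnS leq_eqVlt eqSS.
have NK := N_K; have vK : v.+2 <= K by lia.
set s2 := if splitter X x then exec I emit s1 else s1.
(* The cases of [eS] follow the writes of [emit] in reverse order, since a later write wins. *)
have [[es er2] eO eS eR eF] : [/\ (splitter X x -> safe K I emit s1) /\ reg s2 = reg s1,
    forall a, arr s2 aOut a =
      if splitter X x && (a == arr s aSlot (top X x).+1) then x.+1 else arr s aOut a,
    forall u, arr s2 aSlot u = if splitter X x then
        if u == kid true x then 3 * x.+1 + 1 else if u == kid false x then 3 * x.+1 + 0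
        else if u == (top X x).+1 then 3 * x.+1 + 2 else arr s aSlot u
      else arr s aSlot u,
    forall u, arr s2 aRem u = if splitter X x && (u == x.+1) then 1 else arr s aRem u &
    forall f u, f \notin [:: aRem; aSlot; aOut] -> arr s2 f u = arr s f u].
  rewrite /s2; case sp: (splitter X x); last by split=> *; rewrite ?k2.
  split=> //= [|a|u|u|f u]; rewrite ?v1 ?tx ?k3 ?k4 ?k2 ?addn0 //.
    split=> // _; by move: NK (ltv) vK => h1 h2 h3; do !split; rewrite /=; lia.
  by rewrite !inE => /norP[/negbTE-> /norP[/negbTE-> /negbTE->]] /=.
have [sf ->] : safe K I pass3_body s1 /\ exec I pass3_body s1 = set_reg s2 rV v.+2.
  set e := (EA aGood V * _)%E in cond.
  have E : exec I (CWhen e emit) s1 = s2.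
    have -> : exec I (CWhen e emit) s1 = if ev I e s1 != 0 then exec I emit s1 else s1 by [].
    by rewrite cond /s2; case: (splitter X x).
  have vE : ev I (V + c1)%E s2 = v.+2 by rewrite /= er2 v1 addn1.
  have E2 : exec I pass3_body s1 = set_reg (exec I (CWhen e emit) s1) rV
      (ev I (V + c1)%E (exec I (CWhen e emit) s1)) by [].
  split; last by rewrite E2 E vE.
  have -> : safe K I pass3_body s1 = ((ev I e s1 != 0 -> safe K I emit s1) /\
      ev I (V + c1)%E (exec I (CWhen e emit) s1) <= K) by [].
  by rewrite E vE cond; split=> // h; apply: es; case: splitter h.
clearbody s2; split=> //; exists v.+2; split=> //; first by split=> //; lia.
- by split=> /= [||f u hf]; rewrite ?er2 ?k5 // eF ?sA.
- split=> [|y] /=; rewrite eR ?andbF // eqSS qx ltS.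
  have -> : (y == x :> nat) = (y == x) by [].
  case: (y =P x) => [->|_]; last by rewrite andbF.
  by rewrite andbT; case: splitter; rewrite ?orbT //= !andbF.
(* Processing [x] does not disturb other components: their tops differ from that of [x], and no top
   is a child of [x], because [x] is in [X]. *)
have tt y : splitter X y -> is_top X (top X y) by move/split_in/is_top_top.
have neq y : splitter X y -> y != x -> splitter X x -> top X y != top X x.
  by move=> spy ne spx; apply: contra ne => /eqP e; apply/eqP/(split_uniq spy spx e).
have nk y b : splitter X x -> ((top X y).+1 == kid b x) = false.
  move=> spx; rewrite kid_eq; apply/eqP=> /childOf_parent/top_notin.
  by rewrite split_in.
have lt2 y : y.+1 < v.+2 -> y != x -> y.+1 < v.+1 by rewrite ltS => /orP[->|].
split=> /=.
- move=> y spy lty; rewrite eO; have [exy|ne] := eqVneq y x.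
    by rewrite exy in spy *; rewrite spy l3 ?eqxx.
  rewrite ifF; first exact: o1 (lt2 y lty ne).
  apply/negP=> /andP[spx]; rewrite l3 // => /eqP e.
  have := neq y spy ne spx; rewrite (oi_inj oi (tt y spy) (tt x spx) e) eqxx //.
- move=> a ha; rewrite eO ifF; last first.
    apply/negP=> /andP[spx]; rewrite l3 // => /eqP e.
    by apply: (ha x spx) e; rewrite ltS eqxx.
  by apply: o2 => y spy lty; apply: ha spy _; rewrite ltS lty orbT.
- move=> y b c spy lty ec cX; rewrite eS; have [exy|ne] := eqVneq y x.
    rewrite exy in spy ec *; rewrite spy !kid_eq.
    by case: b ec => ec; rewrite ec ?eqxx //; case: eqP => // /childOf_inj/(_ ec)[].
  case spx: (splitter X x); last exact: l1 (lt2 y lty ne) ec cX.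
  have nkc b' : (c.+1 == kid b' x) = false.
    by rewrite kid_eq; apply/eqP=> /childOf_inj/(_ ec)[_ e]; rewrite e eqxx in ne.
  (* The child [c] is not the top of the component of [x], because its parent [y] is in [X]. *)
  rewrite !nkc ifF; first exact: l1 (lt2 y lty ne) ec cX.
  apply/eqP=> -[/val_inj e]; have yc := childOf_parent ec.
  have := parentOf_nanc yc; rewrite {1}e -(top_top X x) -e (top_par yc) ?top_anc //.
  exact: split_in.
- move=> y spy lty ty; rewrite eS; have [exy|ne] := eqVneq y x.
    by rewrite exy in spy *; rewrite spy !nk // eqxx.
  case spx: (splitter X x); last exact: l2 (lt2 y lty ne) ty.
  rewrite !nk // eqSS ifF; first exact: (l2 y spy (lt2 y lty ne) ty).
  exact: negbTE (neq y spy ne spx).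
- move=> y spy lty; rewrite eS.
  have ne : y != x by apply: contraTneq lty => ->; rewrite ltnn.
  case spx: (splitter X x); last by apply: l3 => //; apply: ltnW.
  rewrite !nk // eqSS ifF; first by apply: l3 => //; apply: ltnW.
  exact: negbTE (neq y spy ne spx).
Qed.

Lemma pass3_ok X s : reg s rN = N -> removed X s -> outinv X (slots s) (arr s aOut) ->
  one_below X -> arr s aGood 0 = 0 ->
  (forall x, arr s aGood x.+1 = good X x /\ arr s aTop x.+1 = (top X x).+1) ->
  exists n s', [/\ n <= N.+2 * (20 + csz pass3), bs K I pass3 s n s',
    same [:: aRem; aSlot; aOut] s s', removed (nxt X) s' &
    outinv (nxt X) (slots s') (arr s' aOut)].
Proof.
move=> eN rx oi ob g0 gt; set s1 := set_reg s rV 1.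
have h1K : 1 <= K by have := N_K; lia.
have b1 : bs K I (CSet rV c1) s (csz (CSet rV c1)) s1 by apply: bs_set.
pose J i (t : st) := inv3 X s i t /\ reg t rN = N.
have J1 : J N s1.
  by split=> //; exists 1; split=> //; split=> [|x]; rewrite ?(proj1 rx) ?(proj2 rx) // andbF orbF.
have [i t [ht tN] ne|n [s' [j [hn hb [[v [v0 [vj er] sm [q0 qx] [o1 o2 l1 l2 _]]] sN] ev0]]]] :=
   @bs_while K I J (V < ER rN + c1)%E (CSeq kids pass3_body)
     (csz (CSeq kids pass3_body)) _ N s1 J1.
  have lt : reg t rV < N.+1 by move: ne; rewrite /= tN addn1; case: (_ < _).
  have [i0 sf ht'] := pass3_step rx oi g0 gt ht tN lt.
  have [m hm hb] := bs_exec sf; exists m; eexists; split=> //; first exact: hb.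
  by split=> //; have [v [_ _ [-> _ _] _ _]] := ht'.
have vN : N < v by move: ev0; rewrite /= er sN addn1 ltnNge; case: leqP.
have lt x : x.+1 < v by apply: leq_ltn_trans vN.
exists (csz (CSet rV c1) + n), s'; split=> //.
- have -> : csz pass3 = csz (CSet rV c1) +
     (size (cE (V < ER rN + c1)%E nreg) + 1 + csz (CSeq kids pass3_body) + 1) by [].
  by move: hn; move: (csz _) (csz _) (size _) => a b d; nia.
- exact: bs_seq b1 hb.
- by split=> // x; rewrite qx lt andbT in_nxt negb_and negbK.
apply: (outinv_step ob oi) => [x spx|a ha|x b c spx|x spx].
- exact: o1 (lt x).
- by apply: o2 => x spx _; apply: ha.
- exact: l1 (lt x).
- exact: l2 (lt x).
Qed.

End Passes.

(** * Correctness and running time *)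

(** The 60 collects the allowance of 20 made for each of the three scans. *)
Definition round_cost :=
  60 + csz pass1 + csz pass2 + csz pass3 + csz (CSet rP (ER rP + ER rP)%E).

Lemma isteps_cons W i c m m1 r :
  istep W i m = Some m1 -> isteps W c m1 = r -> isteps W (i :: c) m = r.
Proof. by move=> /= ->. Qed.

Lemma istep_add W m a b c v : a < W -> b < W -> c < W -> m b + m c = v -> v < W ->
  istep W (IAdd a b c) m = Some (upd m a v).
Proof. by move=> ha hb hc <-; apply: (istep_op (o := Add)). Qed.

Lemma istep_mul W m a b c v : a < W -> b < W -> c < W -> m b * m c = v -> v < W ->
  istep W (IMul a b c) m = Some (upd m a v).
Proof. by move=> ha hb hc <-; apply: (istep_op (o := Mul)). Qed.

Section Main.
Variable T : btree.
Local Notation node := 'I_(bsize T).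
Local Notation N := (bsize T).
Local Notation K := (K T).
Local Notation I := (@I T).
Implicit Types (x y t : node) (X : {set node}) (s : st).

Lemma outinv_ext X slot slot' out out' : (forall x, slot' x = slot x) ->
  (forall a, out' a = out a) -> outinv X slot out -> outinv X slot' out'.
Proof.
move=> es eo [h1 h2 h3 h4]; split=> [t|x b|t u|m Hm Ht].
- by rewrite es; apply: h1.
- by rewrite eo; apply: h2.
- by rewrite !es; apply: h3.
apply: h4 => [a ca na|t tt]; last by rewrite -es; apply: Ht.
by rewrite -eo; apply: Hm => // t tt; rewrite es; apply: na.
Qed.

Definition rinv X s := [/\ reg s rN = N /\ arr s aGood 0 = 0, removed X s,
  arr s aSize 0 = 0 /\ arr s aEdge 0 = 0, outinv X (slots s) (arr s aOut) & one_below X].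

Lemma round_ok X s : rinv X s -> reg s rP + reg s rP <= K ->
  exists n s', [/\ n <= round_cost * N.+2, bs K I round s n s', rinv (nxt X) s'
    & reg s' rP = reg s rP + reg s rP].
Proof.
move=> [[eN g0] rx [z0 e0] oi ob] le_p.
have [n1 [s1 [l1 b1 [N1 P1 A1] sz1]]] := pass1_ok eN rx z0 e0.
have rx1 : removed X s1 by split=> [|x]; rewrite A1 // ?(proj1 rx) ?(proj2 rx).
have [||n2 [s2 [l2 b2 [N2 P2 A2] g2 gt2]]] := @pass2_ok T X s1 _ rx1 sz1; rewrite ?N1 ?A1 //.
have rx2 : removed X s2 by split=> [|x]; rewrite A2 // ?(proj1 rx1) ?(proj2 rx1).
have oi2 : outinv X (slots s2) (arr s2 aOut).
  by apply: outinv_ext oi => [x|a]; rewrite /slots A2 ?A1.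
have [|n3 [s3 [l3 b3 [N3 P3 A3] rx3 oi3]]] := @pass3_ok T X s2 _ rx2 oi2 ob g2 gt2.
  by rewrite N2 N1.
have eP : reg s3 rP = reg s rP by rewrite P3 P2 P1.
have leP : ev I (ER rP + ER rP)%E s3 <= K by rewrite /= eP.
exists (n1 + (n2 + (n3 + csz (CSet rP (ER rP + ER rP)%E)))).
exists (set_reg s3 rP (ev I (ER rP + ER rP)%E s3)); split.
- by move: l1 l2 l3; rewrite /round_cost; move: (csz _) (csz _) (csz _) (csz _) => a b c d; nia.
- exact: bs_seq b1 (bs_seq b2 (bs_seq b3 (bs_set _ leP))).
- have [sz0 ez0 _] := sz1; split=> //=.
  + by rewrite N3 N2 N1 A3.
  + by rewrite !A3 // !A2.
  + exact: one_below_nxt.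
- by rewrite /= eP.
Qed.

Definition loop_cost := size (cE (ER rP < ER rN * ER rN + c1)%E nreg) + 2.

Lemma main_ok s : bounded K s -> (forall f v, arr s f v = 0) ->
  exists n s', [/\ n <= csz main + (2 * trunc_log 2 N + 3) * (loop_cost + round_cost * N.+2),
    bs K I main s n s' &
    exists tr, decodes (arr s' aOut) 3 (reg s' rO) tr /\ is_mcd [set: node] tr].
Proof.
move=> bd h0; have NK := N_K T.
set s1 := set_reg s rN N; set s2 := set_reg s1 rP 1.
have b1 : bs K I (CSet rN (EI c0)) s (csz (CSet rN (EI c0))) s1.
  by apply: bs_set; rewrite /= I0; lia.
have b2 : bs K I (CSet rP c1) s1 (csz (CSet rP c1)) s2.
  by apply: bs_set; rewrite /=; lia.
(* [rP] doubles while all weights halve, so their product stays within [N ^ 2]; [i] bounds the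
   number of doublings until [rP] exceeds [N ^ 2]. *)
pose J i s := exists X, [/\ rinv X s, 0 < reg s rP, N ^ 2 < reg s rP * 2 ^ i &
  forall x, x \in X -> wt X x * reg s rP <= N ^ 2].
(* This is [N < 2 ^ (trunc_log 2 N).+1], squared. *)
have J2 : J (2 * (trunc_log 2 N).+1) s2.
  exists [set: node]; split=> //.
  - split; rewrite /= ?h0 //; last by move=> x x' y y' _ _ _; rewrite inE.
      by split=> [|x] /=; rewrite h0 ?inE.
    by apply: outinv_ext (outinv0 T) => [x|a]; rewrite /slots /= h0.
  - rewrite mul1n mulnC expnM ltn_sqr.
    exact: trunc_log_ltn.
  (* Nothing is removed yet, so the factor for an edge from below is 1. *)
  - move=> x _; rewrite /wt muln1 (_ : xm _ _ = false) ?muln1 ?leq_sqr.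
      by apply: leq_trans (max_card _) _; rewrite card_ord.
    by apply/negbTE/negP=> /existsP[z]; rewrite inE.
have [i t [X [ri p0 lt_i wX]] ne|n [s3 [j [hn b3 [X [ri p0 lt_j wX]] ev0]]]] :=
  @bs_while K I J (ER rP < ER rN * ER rN + c1)%E round (round_cost * N.+2) _ _ _ J2.
  have [[eN _] _ _ _ _] := ri.
  have le_p : reg t rP <= N ^ 2.
    by move: ne; rewrite /= eN addn1 ltnS mulnn; case: (_ <= _).
  have [|m [t' [hm bm ri' eP]]] := round_ok ri.
    by move: le_p; rewrite /K -!mulnn; nia.
  exists m, t'; split=> //.
    by rewrite lt0n; apply: contraTneq lt_i => ->; rewrite muln1 -leqNgt.
  have i0 : 0 < i by rewrite lt0n; apply: contraTneq lt_i => ->; rewrite muln1 -leqNgt.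
  exists (nxt X); split=> //; first by rewrite eP; lia.
    have e : 2 ^ i = 2 * 2 ^ i.-1 by rewrite -expnS prednK.
    by move: lt_i; rewrite e eP mulnA mulnC muln2 addnn mulnC.
  move=> x xX'; have := wX x (nxt_in xX'); have := wt_nxt xX'; rewrite eP.
  by move: (wt _ _) (wt _ _) => a b; nia.
have [[eN _] _ _ oi _] := ri.
have gt_p : N ^ 2 < reg s3 rP by move: ev0; rewrite /= eN addn1 ltnS mulnn ltnNge; case: (_ <= _).
(* A remaining node would have weight at least 1, but weight times [rP] is at most [N ^ 2 < rP]. *)
have X0 x : x \notin X.
  apply/negP=> xX; have := wX x xX.
  have : 0 < wt X x.
    by rewrite /wt muln_gt0 expn_gt0 andbT; apply/orP; left; apply/card_gt0P; exists x; rewrite compoE xX eqxx.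
  by move: (wt X x) gt_p => a; nia.
have bd3 : bounded K s3.
  exact: bs_bounded b3 (bs_bounded b2 (bs_bounded b1 bd)).
have b4 := @bs_set K I rO (EA aOut c0) s3 (bd3.2 _ _).
exists (csz (CSet rN (EI c0)) + (csz (CSet rP c1) + (n + csz (CSet rO (EA aOut c0))))).
exists (set_reg s3 rO (arr s3 aOut 0)); split.
- have -> : csz main = csz (CSet rN (EI c0)) + (csz (CSet rP c1) +
     (csz (CWhile (ER rP < ER rN * ER rN + c1)%E round) + csz (CSet rO (EA aOut c0)))) by [].
  move: hn; rewrite -/loop_cost.
  have -> : (2 * (trunc_log 2 N).+1).+1 = 2 * trunc_log 2 N + 3 by lia.
  by move: (csz _) (csz _) (csz _) (csz _) => a b c d; lia.
- exact: bs_seq b1 (bs_seq b2 (bs_seq b3 b4)).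
- have [||tr [d1 d2]] := oi_mcd oi (m := arr s3 aOut) => //.
    by move=> t /andP[tX]; rewrite (negbTE (X0 t)) in tX.
  by exists tr.
Qed.

End Main.

(* Stores the array stride [16 * (n + 2) ^ 2] in memory cell 1, where [n] is the number of nodes. *)
Definition prologue : seq instr :=
  [:: IConst 3 2; IAdd 1 0 3; IMul 1 1 1; IConst 3 16; IMul 1 1 3].
(** The base address is that of entry 3 of [aOut]: the cells of node [j] start at entry
    [3 * j.+1]. *)
Definition epilogue : seq instr :=
  [:: IConst 3 0; IAdd 0 (ra rO) 3; IConst 3 aOut; IMul 1 1 3; IConst 3 3; IAdd 1 1 3].
Definition program : seq instr := prologue ++ cC main 5 ++ epilogue.

(** With [Q] two more than the number of nodes, [K = 4 * Q ^ 2 <= Q ^ 4], hence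
    [K ^ 16 <= Q ^ 64 < Q ^ 65]. The first bound makes room for the arrays, [narr] times the stride
    being [128 * Q ^ 2]. *)
Lemma word_bounds Q W : 3 <= Q -> Q ^ 65 <= W -> Q ^ 2 * 729 < W /\ (4 * Q ^ 2) ^ 16 < W.
Proof.
move=> Q3 hW; have Q9 : 9 <= Q ^ 2 by rewrite -[9]/(3 ^ 2) leq_sqr.
have Q1 : 1 < Q by apply: leq_trans Q3.
split; apply: leq_trans hW.
  apply: (@leq_trans (Q ^ 9)); last by rewrite leq_pexp2l // ltnW.
  have h7 : 3 ^ 7 <= Q ^ 7 by rewrite leq_exp2r.
  rewrite (_ : 9 = 2 + 7) // expnD ltn_mul2l (leq_trans _ h7) // andbT.
  exact: ltn_trans Q9.
apply: (@leq_ltn_trans ((Q ^ 4) ^ 16)); last by rewrite -expnM ltn_exp2l.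
rewrite leq_exp2r // (_ : Q ^ 4 = Q ^ 2 * Q ^ 2); last by rewrite -expnD.
rewrite leq_mul2r.
by apply/orP; right; apply: leq_trans Q9.
Qed.

Lemma program_ok T W : (bsize T + 2) ^ 2 * 729 < W -> K T ^ 16 < W ->
  exists n s', [/\ n <= 11 + (csz main +
      (2 * trunc_log 2 (bsize T) + 3) * (loop_cost + round_cost * (bsize T).+2)),
    steps W program n (0, input T) = Some s', is_halt (nth IHalt program s'.1) &
    exists tr, decodes s'.2 (s'.2 1) (s'.2 0) tr /\ is_mcd [set: 'I_(bsize T)] tr].
Proof.
set N := bsize T; set Q := N + 2 => QW; have N0 : 0 < N by apply: bsize_gt0.
have Q3 : 3 <= Q by rewrite /Q; lia.
pose M := Q ^ 2 * 16.
have Q9 : 9 <= Q ^ 2 by rewrite -mulnn; nia.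
have KE : K T = 4 * Q ^ 2 by [].
have KM : (K T).*2 < M by rewrite KE /M; lia.
have M100 : 100 <= M by rewrite /M; lia.
have MW : narr * M <= W by rewrite /M /narr; lia.
have K4 : 4 <= K T by rewrite KE; lia.
have [mp [hp m1 mM]] : exists mp, [/\ isteps W prologue (input T) = Some mp, mp 1 = M &
    forall a, a != 1 -> mp a = if a == 3 then 16 else input T a].
  have m0 : input T 0 = N by [].
  exists (upd (upd (upd (upd (upd (input T) 3 2) 1 Q) 1 (Q * Q)) 3 16) 1 (Q * Q * 16)).
  split.
  - apply: (isteps_cons (istep_const _ _ _)); try lia.
    apply: (isteps_cons (istep_add (v := Q) _ _ _ _ _)); try lia; try (rewrite /upd /=; lia).
    apply: (isteps_cons (istep_mul (v := Q * Q) _ _ _ _ _)); try lia; try (rewrite /upd /=; lia).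
    apply: (isteps_cons (istep_const _ _ _)); try lia.
    apply: (isteps_cons (istep_mul (v := Q * Q * 16) _ _ _ _ _)); try lia; try (rewrite /upd /=; lia).
    by [].
  - by rewrite upd_eq /M mulnn.
  - move=> a a1; rewrite /upd (negbTE a1).
    by case: (a == 3).
(* The registers start with whatever the odd cells contain, mostly codes of left children; the
   arrays lie beyond the input and start at 0. *)
pose s0 := St (fun r => if r == 0 then 0 else mp (ra r)) (fun _ _ => 0).
have bd0 : bounded (K T) s0.
  split=> //= -[|r] //=; rewrite mM /ra //; case: eqP => _; first by rewrite KE; lia.
  by apply: leq_trans (input_le _ _) _; have := N_K T; rewrite -/N; lia.
have rp0 : rep M (K T) (@I T) mp s0.
  split=> // [[|r] //|f v|x].
  - move=> /andP[f0 _] _; have h : M <= f * M + v by rewrite -{1}(mul1n M) (leq_trans _ (leq_addr _ _)) // leq_mul2r f0 orbT.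
    have QN : N.*2 < M by rewrite /M -mulnn /Q; nia.
    rewrite mM ?ifF; try lia.
    rewrite /input ifF; last by lia.
    by rewrite ifF //; lia.
  - by move=> _; rewrite mM ?ifF //; lia.
have [n [s' [hn hb [tr [d1 d2]]]]] := main_ok bd0 (fun _ _ => erefl).
have wf : wfC main by vm_compute.
have hc : code_at program 5 (cC main 5) by exists prologue, epilogue.
have hpro : code_at program 0 prologue by exists [::], (cC main 5 ++ epilogue).
have hepi : code_at program (5 + csz main) epilogue.
  by exists (prologue ++ cC main 5), [::]; rewrite size_cat size_cC cats0 /program -catA.
move=> KW; have [m' [hst [r0 r1 r2 r3]]] := cC_ok K4 (@I_le T) KM M100 MW KW hb wf bd0 hc rp0.
clear KW.
have bd' := bs_bounded hb bd0.
have eO : m' (ra rO) = reg s' rO by rewrite r1.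
have [mf [hf f0 f1 fM]] : exists mf, [/\ isteps W epilogue m' = Some mf, mf 0 = reg s' rO,
    mf 1 = aOut * M + 3 & forall a, M <= a -> mf a = m' a].
  have h1 : m' 1 = M by [].
  have hO := bd'.1 rO; have eO' : m' 13 = reg s' rO by [].
  have h13 : ra rO < W by rewrite /ra /=; lia.
  exists (upd (upd (upd (upd (upd (upd m' 3 0) 0 (reg s' rO)) 3 aOut) 1 (M * aOut)) 3 3)
    1 (M * aOut + 3)).
  split.
  - apply: (isteps_cons (istep_const _ _ _)); try lia.
    apply: (isteps_cons (istep_add (v := reg s' rO) _ _ _ _ _)); try lia; try (rewrite /upd /= addn0; exact: eO').
    apply: (isteps_cons (istep_const _ _ _)); try lia.
    apply: (isteps_cons (istep_mul (v := M * aOut) _ _ _ _ _)); try lia; try (rewrite /upd /= ?h1; lia).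
    apply: (isteps_cons (istep_const _ _ _)); try lia.
    apply: (isteps_cons (istep_add (v := M * aOut + 3) _ _ _ _ _)); try lia; try (rewrite /upd /=; lia).
    by [].
  - by [].
  - by rewrite upd_eq mulnC.
  - by move=> a ha; rewrite !upd_neq //; lia.
exists (5 + (n + 6)), (5 + csz main + 6, mf); split.
- by rewrite addnCA addnC -addnA leq_add2l.
- apply: steps_trans (steps_isteps hpro hp) _.
  exact: steps_trans hst (steps_isteps hepi hf).
- rewrite /program nth_default // !size_cat size_cC /=; lia.
exists tr; split=> //=; rewrite f0 f1.
apply: decodes_transfer d2 d1 => a ha.
have aK : 3 + a <= K T by have := N_K T; lia.
by rewrite -addnA fM ?r2 //; nia.
Qed.

Theorem theorem1 :
  exists (P : seq instr) (c k : nat),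
  forall (T : btree) (W : nat),
    (bsize T + 2) ^ k <= W ->
    exists s' : state,
      run W P (c * nleaves T * (trunc_log 2 (nleaves T)).+1) (0, input T) = Some s' /\
      exists t : mtree,
        decodes s'.2 (s'.2 1) (s'.2 0) t /\ is_mcd [set: 'I_(bsize T)] t.
Proof.
(* With [m] leaves and [l = trunc_log 2 m], there are at most [2 * l + 5 <= 5 * l.+1] loop tests,
   and a round costs at most [round_cost * (3 * m)]; hence the factors 5 and 15. *)
exists program, (11 + csz main + 5 * loop_cost + 15 * round_cost), 65 => T W hW.
have [|QW KW] := word_bounds _ hW; first by rewrite -[3]/(1 + 2) leq_add2r bsize_gt0.
have [n [s' [hn hs hh ht]]] := program_ok QW KW.
clear hW QW KW; exists s'; split=> //; apply: run_steps hs hh _; apply: leq_trans hn _.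
have eN := bsize_nleaves T; set m := nleaves T in eN *.
have m0 : 0 < m by have := bsize_gt0 T; lia.
have le_log : trunc_log 2 (bsize T) <= (trunc_log 2 m).+1.
  rewrite -ltnS -(ltn_exp2l _ _ (isT : 1 < 2)).
  apply: leq_ltn_trans (trunc_logP _ (bsize_gt0 T)) _ => //.
  have := trunc_log_ltn m (isT : 1 < 2); rewrite !expnS; lia.
move: le_log; set l := trunc_log 2 m; set l' := trunc_log _ _ => le_log.
move: (csz main) loop_cost round_cost => a b c.
apply: (@leq_trans (11 + (a + 5 * l.+1 * (b + c * (3 * m))))).
  rewrite leq_add2l leq_add2l leq_mul //; first by lia.
  by rewrite leq_add2l leq_mul2l; apply/orP; right; lia.
have h1 : 11 + a <= (11 + a) * (m * l.+1) by rewrite leq_pmulr // muln_gt0 m0.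
have h2 : b * l.+1 <= b * (m * l.+1) by rewrite leq_mul2l leq_pmull ?orbT.
by move: h1 h2; move: l.+1 => k; lia.
Qed.
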